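(* Consider the vectorial $\mathrm{D}_2\mathrm{Q}_5^3$ lattice Boltzmann scheme described in the context, under the parabolic scaling $\Delta x^2/\Delta t=\mu>0$ with $\mu$ fixed. Assume that the numerical solution is obtained as a point-wise sampling of underlying smooth functions of the time and space variables. Then, in the limit $\Delta x\ll 1$, the underlying smooth function corresponding to the conserved moment $\rho$ formally fulfills $$\partial_t\rho+\partial_x q_x+\partial_y q_y-2\mu\alpha_\rho\Bigl(\frac{1}{\omega_\rho}-\frac12\Bigr)(\partial_{xx}\rho+\partial_{yy}\rho)=\mathcal{O}(\Delta x^2).$$ Assuming that $$P(\rho(t,x,y))=P(\overline{\rho})+\Delta x^2\,\overline{\rho}\,\Phi(t,x,y)+\mathcal{O}(\Delta x^3),$$ where $\overline{\rho}>0$ is independent of space and time, the other two conserved moments (formally) fulfill $$\partial_t q_x+\partial_x\Bigl(\frac{q_x^2}{\rho}+\overline{\rho}\,\Phi\Bigr)+\partial_y\Bigl(\frac{q_xq_y}{\rho}\Bigr)-2\mu\alpha_{q_x}\Bigl(\frac{1}{\omega_{q_x}}-\frac12\Bigr)(\partial_{xx}q_x+\partial_{yy}q_x)=\mathcal{O}(\Delta x^2),$$ $$\partial_t q_y+\partial_x\Bigl(\frac{q_xq_y}{\rho}\Bigr)+\partial_y\Bigl(\frac{q_y^2}{\rho}+\overline{\rho}\,\Phi\Bigr)-2\mu\alpha_{q_y}\Bigl(\frac{1}{\omega_{q_y}}-\frac12\Bigr)(\partial_{xx}q_y+\partial_{yy}q_y)=\mathcal{O}(\Delta x^2).$$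
   Context: Scheme. Let $\Delta t,\Delta x>0$ with $\Delta x^2/\Delta t=\mu>0$ fixed, $t\in\Delta t\,\mathbb{N}$ and $x,y\in\Delta x(\mathbb{Z}+\frac12)$. The discrete velocities are labelled by $\ell\in\{0,x^+,y^+,x^-,y^-\}$, with directions $c_0=(0,0)$, $c_{x^\pm}=(\pm1,0)$, $c_{y^\pm}=(0,\pm1)$. To each $\ell$ is associated a distribution function $\mathbf{f}_\ell(t,x,y)\in\mathbb{R}^3$. The conserved moments $\rho,q_x,q_y$ are defined by $$(\rho,\ \Delta x\,q_x,\ \Delta x\,q_y)^{T}(t,x,y)=\sum_{\ell}\mathbf{f}_\ell(t,x,y).$$ One time step consists of: (i) Relaxation: $$\mathbf{f}_\ell^{\star}(t,x,y)=\mathrm{diag}(1-\omega_\rho,1-\omega_{q_x},1-\omega_{q_y})\,\mathbf{f}_\ell(t,x,y)+\mathrm{diag}(\omega_\rho,\omega_{q_x},\omega_{q_y})\,\mathbf{f}_\ell^{\rm eq}\bigl(\rho(t,x,y),q_x(t,x,y),q_y(t,x,y)\bigr),$$ with relaxation parameters $\omega_\rho,\omega_{q_x},\omega_{q_y}\in(0,2]$. (ii) Transport: $\mathbf{f}_\ell(t+\Delta t,(x,y))=\mathbf{f}_\ell^{\star}(t,(x,y)-\Delta x\,c_\ell)$. The initial distribution functions are taken at equilibrium. The equilibria are $$\mathbf{f}_0^{\rm eq}=\begin{pmatrix}(1-4\alpha_\rho)\rho\\ (1-4\alpha_{q_x})\Delta x\,q_x\\ (1-4\alpha_{q_y})\Delta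 x\,q_y\end{pmatrix},$$ $$\mathbf{f}_{x^\pm}^{\rm eq}=\begin{pmatrix}\alpha_\rho\rho\pm\frac{\Delta x}{2\mu}q_x\\ \Delta x\,\alpha_{q_x}q_x\pm\frac{\Delta x^2}{2\mu}\frac{q_x^2}{\rho}\pm\frac{1}{2\mu}P(\rho)\\ \Delta x\,\alpha_{q_y}q_y\pm\frac{\Delta x^2}{2\mu}\frac{q_xq_y}{\rho}\end{pmatrix},\qquad \mathbf{f}_{y^\pm}^{\rm eq}=\begin{pmatrix}\alpha_\rho\rho\pm\frac{\Delta x}{2\mu}q_y\\ \Delta x\,\alpha_{q_x}q_x\pm\frac{\Delta x^2}{2\mu}\frac{q_xq_y}{\rho}\\ \Delta x\,\alpha_{q_y}q_y\pm\frac{\Delta x^2}{2\mu}\frac{q_y^2}{\rho}\pm\frac{1}{2\mu}P(\rho)\end{pmatrix},$$ where $\alpha_\rho,\alpha_{q_x},\alpha_{q_y}\in\mathbb{R}$ are coefficients to be chosen and $P(\rho)=\rho^\gamma$ with $\gamma\ge1$. The function $\Phi$ is a function of time and space (the pressure-type Lagrange multiplier of the incompressible Navier–Stokes system). ''Formally'' means that the statement is understood at the level of formal Taylor expansions in $\Delta x$: the underlying smooth functions are inserted in the relaxation and transport relations, the time and space shifts are Taylor-expanded, and derivatives of the smooth functions are treated as bounded as $\Delta x\to0$.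
   Formalization: For the momentum equations, the O(Δx²) bound is proved if q_x, q_y are independent of Δx up to O(Δx²), or if the pressure remainder is O(Δx⁴); otherwise the O(Δx³) remainder gives only O(Δx), since the printed claim fails for Δx-dependent functions. *)

(* Defs.v *)
(* Library world: Stdlib real numbers with Coquelicot. *)
From Stdlib Require Import Reals ZArith List.
From Coquelicot Require Import Coquelicot.
Open Scope R_scope.

(** * Discrete velocities, moments and equilibria *)

Inductive velocity := V0 | Vxp | Vyp | Vxm | Vym.

Definition cx (l : velocity) : Z :=
  match l with Vxp => 1 | Vxm => -1 | _ => 0 end%Z.

Definition cy (l : velocity) : Z :=
  match l with Vyp => 1 | Vym => -1 | _ => 0 end%Z.

Definition sum_velocities (g : velocity -> R) : R :=
  g V0 + g Vxp + g Vyp + g Vxm + g Vym.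

(* Labels of the three components of each distribution function, one for each
   conserved moment; they also index the relaxation and the equilibrium
   coefficients. *)
Inductive moment := Mrho | Mqx | Mqy.

(* [Rpower] is the real power only for a positive base; it is used below for
   positive densities. *)
Definition pressure (gamma rho : R) : R := Rpower rho gamma.

(* [h] is the space step. *)
Definition feq_rest (alpha : moment -> R) (h rho qx qy : R) (m : moment) : R :=
  match m with
  | Mrho => (1 - 4 * alpha Mrho) * rho
  | Mqx => (1 - 4 * alpha Mqx) * h * qx
  | Mqy => (1 - 4 * alpha Mqy) * h * qy
  end.

(* Equilibria of the velocities along each axis; [s] = 1 or -1 is the sign of
   the velocity. *)
Definition feq_x (mu gamma : R) (alpha : moment -> R) (s : R)
    (h rho qx qy : R) (m : moment) : R :=
  match m with
  | Mrho => alpha Mrho * rho + s * (h / (2 * mu) * qx)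
  | Mqx => h * alpha Mqx * qx + s * (h ^ 2 / (2 * mu) * (qx ^ 2 / rho))
           + s * (1 / (2 * mu) * pressure gamma rho)
  | Mqy => h * alpha Mqy * qy + s * (h ^ 2 / (2 * mu) * (qx * qy / rho))
  end.

Definition feq_y (mu gamma : R) (alpha : moment -> R) (s : R)
    (h rho qx qy : R) (m : moment) : R :=
  match m with
  | Mrho => alpha Mrho * rho + s * (h / (2 * mu) * qy)
  | Mqx => h * alpha Mqx * qx + s * (h ^ 2 / (2 * mu) * (qx * qy / rho))
  | Mqy => h * alpha Mqy * qy + s * (h ^ 2 / (2 * mu) * (qy ^ 2 / rho))
           + s * (1 / (2 * mu) * pressure gamma rho)
  end.

Definition feq (mu gamma : R) (alpha : moment -> R) (h : R) (l : velocity)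
    (rho qx qy : R) (m : moment) : R :=
  match l with
  | V0 => feq_rest alpha h rho qx qy m
  | Vxp => feq_x mu gamma alpha 1 h rho qx qy m
  | Vxm => feq_x mu gamma alpha (-1) h rho qx qy m
  | Vyp => feq_y mu gamma alpha 1 h rho qx qy m
  | Vym => feq_y mu gamma alpha (-1) h rho qx qy m
  end.

(** * The scheme *)

(* [f n i j l m] is the component [m] of the distribution function of velocity
   [l] at time [n * dt] and at the cell centre [((i + 1/2) h, (j + 1/2) h)],
   where [dt = h ^ 2 / mu]. *)
Definition distribution := nat -> Z -> Z -> velocity -> moment -> R.

Definition time_at (mu h : R) (n : nat) : R := INR n * (h ^ 2 / mu).
Definition space_at (h : R) (i : Z) : R := h * (IZR i + 1 / 2).

Definition moment_sum (f : distribution) (m : moment) (n : nat) (i j : Z) : R :=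
  sum_velocities (fun l => f n i j l m).

Definition num_rho (f : distribution) := moment_sum f Mrho.
Definition num_qx (h : R) (f : distribution) (n : nat) (i j : Z) : R :=
  moment_sum f Mqx n i j / h.
Definition num_qy (h : R) (f : distribution) (n : nat) (i j : Z) : R :=
  moment_sum f Mqy n i j / h.

Definition feq_of (mu gamma : R) (alpha : moment -> R) (h : R)
    (f : distribution) : distribution :=
  fun n i j l m =>
    feq mu gamma alpha h l (num_rho f n i j) (num_qx h f n i j)
      (num_qy h f n i j) m.

Definition relaxed (mu gamma : R) (alpha omega : moment -> R) (h : R)
    (f : distribution) : distribution :=
  fun n i j l m =>
    (1 - omega m) * f n i j l m + omega m * feq_of mu gamma alpha h f n i j l m.

Record lbm_solution (mu gamma : R) (alpha omega : moment -> R) (h : R)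
    (f : distribution) : Prop := {
  lbm_init : forall i j l m,
    f 0%nat i j l m = feq_of mu gamma alpha h f 0%nat i j l m;
  lbm_transport : forall n i j l m,
    f (S n) i j l m =
      relaxed mu gamma alpha omega h f n (i - cx l)%Z (j - cy l)%Z l m
}.

(** * Smooth functions of time and space *)

Definition field := R -> R -> R -> R.

Inductive direction := dir_t | dir_x | dir_y.

Definition Dt (g : field) : field := fun t x y => Derive (fun s => g s x y) t.
Definition Dx (g : field) : field := fun t x y => Derive (fun s => g t s y) x.
Definition Dy (g : field) : field := fun t x y => Derive (fun s => g t x s) y.

Definition partial (d : direction) : field -> field :=
  match d with dir_t => Dt | dir_x => Dx | dir_y => Dy end.

Definition ex_partial (d : direction) (g : field) (t x y : R) : Prop :=
  match d with
  | dir_t => ex_derive (fun s => g s x y) t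
  | dir_x => ex_derive (fun s => g t s y) x
  | dir_y => ex_derive (fun s => g t x s) y
  end.

Fixpoint partials (ds : list direction) (g : field) : field :=
  match ds with
  | nil => g
  | d :: ds' => partial d (partials ds' g)
  end.

(* C^oo on the open half-space of positive times: all iterated partial
   derivatives exist and are jointly continuous.  The time t = 0 is left out
   because of the initial layer which initial data at equilibrium create. *)
Definition smooth (g : field) : Prop :=
  forall (ds : list direction) (t x y : R), 0 < t ->
    (forall d : direction, ex_partial d (partials ds g) t x y) /\
    continuous (fun p : R * R * R =>
      partials ds g (fst (fst p)) (snd (fst p)) (snd p)) ((t, x), y).

(** * Families indexed by the space step, and orders of magnitude *)

(* [g h t x y] = O(h ^ k) as h -> 0+, locally uniformly in (t, x, y), t > 0. *)
Definition bigO (k : nat) (g : R -> field) : Prop :=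
  forall a b r : R, 0 < a ->
  exists C h0 : R, 0 < h0 /\
    forall h t x y : R, 0 < h < h0 ->
      a <= t <= b -> Rabs x <= r -> Rabs y <= r ->
      Rabs (g h t x y) <= C * h ^ k.

(* O(h ^ k) in the sense of formal expansions, which may be differentiated term
   by term: the estimate holds for all derivatives.  For k = 0 it says that all
   the derivatives remain bounded as h -> 0. *)
Definition smooth_bigO (k : nat) (g : R -> field) : Prop :=
  forall ds : list direction, bigO k (fun h => partials ds (g h)).

(* [g] is a fixed function of time and space up to a correction O(h ^ k). *)
Definition mesh_independent_up_to (k : nat) (g : R -> field) : Prop :=
  exists g0 : field, smooth g0 /\
    smooth_bigO k (fun h t x y => g h t x y - g0 t x y).

(* The numerical solutions [f h], for h in (0, H), have their conserved moments
   sampled from smooth functions with bounded derivatives as h -> 0. *)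
Record sampled_from (mu H : R) (f : R -> distribution)
    (rho qx qy : R -> field) : Prop := {
  sampled_rho : forall (h : R) (n : nat) (i j : Z), 0 < h < H ->
    num_rho (f h) n i j
      = rho h (time_at mu h n) (space_at h i) (space_at h j);
  sampled_qx : forall (h : R) (n : nat) (i j : Z), 0 < h < H ->
    num_qx h (f h) n i j
      = qx h (time_at mu h n) (space_at h i) (space_at h j);
  sampled_qy : forall (h : R) (n : nat) (i j : Z), 0 < h < H ->
    num_qy h (f h) n i j
      = qy h (time_at mu h n) (space_at h i) (space_at h j);
  sampled_smooth : forall h : R, 0 < h < H ->
    smooth (rho h) /\ smooth (qx h) /\ smooth (qy h);
  sampled_bounded : smooth_bigO 0 rho /\ smooth_bigO 0 qx /\ smooth_bigO 0 qy;
  sampled_positive : forall h t x y : R, 0 < h < H -> 0 <= t ->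
    0 < rho h t x y
}.

(* P(rho) = P(rhobar) + h ^ 2 rhobar Phi + O(h ^ k) *)
Definition pressure_expansion (k : nat) (gamma : R) (rho : R -> field)
    (rhobar : R) (Phi : field) : Prop :=
  smooth_bigO k (fun h t x y =>
    pressure gamma (rho h t x y)
      - (pressure gamma rhobar + h ^ 2 * rhobar * Phi t x y)).

(** * Left-hand sides of the limit equations *)

Definition laplacian (g : field) : field :=
  fun t x y => Dx (Dx g) t x y + Dy (Dy g) t x y.

Definition mass_lhs (mu alpha omega : R) (rho qx qy : field) : field :=
  fun t x y =>
    Dt rho t x y + Dx qx t x y + Dy qy t x y
    - 2 * mu * alpha * (1 / omega - 1 / 2) * laplacian rho t x y.

Definition momentum_x_lhs (mu alpha omega rhobar : R)
    (Phi rho qx qy : field) : field :=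
  fun t x y =>
    Dt qx t x y
    + Dx (fun t x y => qx t x y ^ 2 / rho t x y + rhobar * Phi t x y) t x y
    + Dy (fun t x y => qx t x y * qy t x y / rho t x y) t x y
    - 2 * mu * alpha * (1 / omega - 1 / 2) * laplacian qx t x y.

Definition momentum_y_lhs (mu alpha omega rhobar : R)
    (Phi rho qx qy : field) : field :=
  fun t x y =>
    Dt qy t x y
    + Dx (fun t x y => qx t x y * qy t x y / rho t x y) t x y
    + Dy (fun t x y => qy t x y ^ 2 / rho t x y + rhobar * Phi t x y) t x y
    - 2 * mu * alpha * (1 / omega - 1 / 2) * laplacian qy t x y.

(* Main.v *)
Require Import Defs.
From Stdlib Require Import Reals ZArith List.
From Coquelicot Require Import Coquelicot.
From Stdlib Require Import Lra Lia ClassicalEpsilon.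
Open Scope R_scope.

(** Each of the three conserved moments follows a linear five-velocity scheme
    for one scalar unknown [u], with equilibria [(1 - 4 alpha) u] at rest and
    [alpha u +- (h / (2 mu) A + const)], [alpha u +- (h / (2 mu) B + const)]
    along the axes.  For the mass the fluxes [A] and [B] are [qx] and [qy].
    For a momentum component, divided by [h], they are the convective fluxes,
    to which the pressure contributes [(P(rho) - P(rhobar)) / h ^ 2]; this
    quotient has bounded derivatives because of the assumed expansion of the
    pressure, and the large constant [P(rhobar)] cancels between opposite
    velocities.  So everything reduces to [scalar_scheme_consistent]: the scalar
    scheme yields
    [dt u + dx A + dy B - 2 mu alpha (1 / w - 1 / 2) Laplacian u = O(h ^ 2)],
    with [w] the relaxation parameter.

    The difficulty in that lemma is that only the sums of the distribution
    functions are known to be smooth: the distribution functions themselves may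
    carry an initial layer, which does not even decay for [w = 2].  The layer is
    removed by a finite elimination.  The function at rest, and the sum of the
    two functions along each axis, satisfy recurrences in which only the known
    moments occur; their left-hand sides are the operators [rest_op] and
    [pair_op].  Taylor expansion gives for each of these three grid functions a
    smooth approximation that satisfies its recurrence up to [O(h ^ 4)]
    ([rest_expansion], [pair_expansion]).  The three errors need not be small,
    but the composition of the three operators sends each of them to
    [O(h ^ 4)], hence also their sum; and this sum is smooth, being
    [h ^ 2 / (w mu)] times the left-hand side of the limit equation.  On a smooth
    function of size [h ^ 2] the composed operator is the multiplication by
    [w ^ 5] up to [O(h ^ 4)] ([compose_ops_leading]), and [w] is not zero.  This
    gives the estimate on the grid; the grid is fine enough to extend it to all
    points ([bigO_of_grid]).

    For the momentum equations, replacing [(P(rho) - P(rhobar)) / h ^ 2] by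
    [rhobar Phi] costs the order [k] of the remainder of the pressure divided by
    [h ^ 2] ([momentum_lhs_order]).  With a remainder [O(h ^ 3)] this is only
    [k = 1].  But if moreover the momenta are fixed functions up to [O(h ^ 2)],
    then so is the left-hand side, since the density is [rhobar + O(h ^ 2)]; the
    fixed function in question is [O(h)], hence zero
    ([approx_fixed_improve]). *)

(** * Orders of magnitude of families of fields *)

(** Identities between families are only available where the numerical solution
    exists and the fields are smooth. *)
Definition agree (H : R) (f g : R -> field) : Prop :=
  forall h t x y : R, 0 < h < H -> 0 < t -> f h t x y = g h t x y.

Lemma bigO_agree (H : R) (k : nat) (f g : R -> field) :
  0 < H -> agree H f g -> bigO k f -> bigO k g.
Proof.
intros HH E Of a b r Ha.
destruct (Of a b r Ha) as [C [h0 [Hh0 B]]].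
exists C, (Rmin h0 H); split; [now apply Rmin_pos|].
intros h t x y Hh Ht Hx Hy.
assert (h < h0 /\ h < H) as [H1 H2].
{ split; [apply Rlt_le_trans with (2 := Rmin_l h0 H)
         |apply Rlt_le_trans with (2 := Rmin_r h0 H)]; lra. }
rewrite <- E by lra. apply B; trivial; lra.
Qed.

Lemma bigO_plus (k : nat) (f g : R -> field) :
  bigO k f -> bigO k g -> bigO k (fun h t x y => f h t x y + g h t x y).
Proof.
intros Of Og a b r Ha.
destruct (Of a b r Ha) as [C [h0 [Hh0 B]]].
destruct (Og a b r Ha) as [C' [h0' [Hh0' B']]].
exists (C + C'), (Rmin h0 h0'); split; [now apply Rmin_pos|].
intros h t x y [Hh Hm] Ht Hx Hy.
assert (h < h0) by (apply Rlt_le_trans with (1 := Hm); apply Rmin_l).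
assert (h < h0') by (apply Rlt_le_trans with (1 := Hm); apply Rmin_r).
apply Rle_trans with (1 := Rabs_triang _ _).
rewrite Rmult_plus_distr_r.
apply Rplus_le_compat; [apply B | apply B']; trivial; lra.
Qed.

Lemma bigO_mult (k l : nat) (f g : R -> field) :
  bigO k f -> bigO l g ->
  bigO (k + l) (fun h t x y => f h t x y * g h t x y).
Proof.
intros Of Og a b r Ha.
destruct (Of a b r Ha) as [C [h0 [Hh0 B]]].
destruct (Og a b r Ha) as [C' [h0' [Hh0' B']]].
exists (C * C'), (Rmin h0 h0'); split; [now apply Rmin_pos|].
intros h t x y [Hh Hm] Ht Hx Hy.
assert (h < h0) by (apply Rlt_le_trans with (1 := Hm); apply Rmin_l).
assert (h < h0') by (apply Rlt_le_trans with (1 := Hm); apply Rmin_r).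
rewrite Rabs_mult, pow_add.
replace (C * C' * (h ^ k * h ^ l)) with ((C * h ^ k) * (C' * h ^ l)) by ring.
apply Rmult_le_compat; try apply Rabs_pos; [apply B | apply B']; trivial; lra.
Qed.

Lemma bigO_const (c : R) : bigO 0 (fun _ _ _ _ => c).
Proof.
intros a b r Ha. exists (Rabs c), 1. split; [lra|].
intros. simpl. lra.
Qed.

Lemma bigO_hpow (k : nat) : bigO k (fun h _ _ _ => h ^ k).
Proof.
intros a b r Ha. exists 1, 1. split; [lra|].
intros h t x y Hh _ _ _. rewrite Rabs_pos_eq; [lra|]. apply pow_le; lra.
Qed.

Lemma bigO_weaken (k l : nat) (f : R -> field) :
  (l <= k)%nat -> bigO k f -> bigO l f.
Proof.
intros Hkl Of a b r Ha.
destruct (Of a b r Ha) as [C [h0 [Hh0 B]]].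
exists (Rabs C), (Rmin h0 1); split; [apply Rmin_pos; lra|].
intros h t x y [Hh Hm] Ht Hx Hy.
assert (h < h0) by (apply Rlt_le_trans with (1 := Hm); apply Rmin_l).
assert (h < 1) by (apply Rlt_le_trans with (1 := Hm); apply Rmin_r).
apply Rle_trans with (C * h ^ k); [apply B; trivial; lra|].
replace k with (l + (k - l))%nat by lia. rewrite pow_add.
assert (0 <= h ^ l) by (apply pow_le; lra).
assert (0 <= h ^ (k - l) <= 1).
{ split; [apply pow_le; lra|]. rewrite <- (pow1 (k - l)).
  apply pow_incr; lra. }
pose proof (Rle_abs C). pose proof (Rabs_pos C).
apply Rle_trans with (Rabs C * (h ^ l * h ^ (k - l))).
- apply Rmult_le_compat_r; [apply Rmult_le_pos; lra|lra].
- apply Rmult_le_compat_l; trivial.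
  rewrite <- (Rmult_1_r (h ^ l)) at 2. apply Rmult_le_compat_l; lra.
Qed.

Lemma bigO_scal (k : nat) (c : R) (f : R -> field) :
  bigO k f -> bigO k (fun h t x y => c * f h t x y).
Proof. intro Of. exact (bigO_mult 0 k _ _ (bigO_const c) Of). Qed.

Lemma bigO_hmul (k l : nat) (f : R -> field) :
  bigO l f -> bigO (k + l) (fun h t x y => h ^ k * f h t x y).
Proof. exact (bigO_mult k l _ _ (bigO_hpow k)). Qed.

Lemma bigO_hdiv (k l : nat) (f : R -> field) :
  bigO (k + l) f -> bigO l (fun h t x y => / h ^ k * f h t x y).
Proof.
intros Of a b r Ha.
destruct (Of a b r Ha) as [C [h0 [Hh0 B]]].
exists C, h0; split; trivial. intros h t x y Hh Ht Hx Hy.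
assert (0 < h ^ k) by (apply pow_lt; lra).
rewrite Rabs_mult, Rabs_pos_eq by (apply Rlt_le, Rinv_0_lt_compat; trivial).
apply Rmult_le_reg_l with (h ^ k); trivial.
rewrite <- Rmult_assoc, Rinv_r, Rmult_1_l by lra.
replace (h ^ k * (C * h ^ l)) with (C * h ^ (k + l)) by (rewrite pow_add; ring).
now apply B.
Qed.

Lemma bigO_mult_close (k : nat) (f g f0 g0 : R -> field) :
  bigO 0 f -> bigO 0 g0 ->
  bigO k (fun h t x y => f h t x y - f0 h t x y) ->
  bigO k (fun h t x y => g h t x y - g0 h t x y) ->
  bigO k (fun h t x y => f h t x y * g h t x y - f0 h t x y * g0 h t x y).
Proof.
intros Of Og0 Df Dg.
apply bigO_agree with 1 (fun h t x y =>
  f h t x y * (g h t x y - g0 h t x y)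
  + g0 h t x y * (f h t x y - f0 h t x y)); [lra| |].
- intros h t x y _ _; ring.
- apply bigO_plus; [exact (bigO_mult 0 k _ _ Of Dg)
                   |exact (bigO_mult 0 k _ _ Og0 Df)].
Qed.

Lemma bigO_fixed_zero (g : field) (t x y : R) :
  bigO 1 (fun _ => g) -> 0 < t -> g t x y = 0.
Proof.
intros Og Ht.
destruct (Og t t (Rmax (Rabs x) (Rabs y)) Ht) as [C [h0 [Hh0 B]]].
destruct (Req_dec (g t x y) 0) as [E|E]; trivial. exfalso.
apply Rabs_pos_lt in E.
assert (Bh : forall h, 0 < h < h0 -> Rabs (g t x y) <= C * h).
{ intros h Hh. rewrite <- (pow_1 h). apply B; trivial; try lra.
  apply Rmax_l. apply Rmax_r. }
assert (HC : 0 < C).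
{ pose proof (Bh (h0 / 2) ltac:(lra)). nra. }
set (h := Rmin (h0 / 2) (Rabs (g t x y) / (2 * C))).
assert (0 < Rabs (g t x y) / (2 * C)) by (apply Rdiv_lt_0_compat; lra).
assert (Hh : 0 < h <= h0 / 2) by (split; [apply Rmin_pos; lra|apply Rmin_l]).
assert (C * h <= C * (Rabs (g t x y) / (2 * C))).
{ apply Rmult_le_compat_l; [lra|apply Rmin_r]. }
replace (C * (Rabs (g t x y) / (2 * C))) with (Rabs (g t x y) / 2) in H0
  by (field; lra).
pose proof (Bh h ltac:(lra)). lra.
Qed.

(** * Differentiable families with controlled derivatives *)

(** Restrictions to lines let time and the two space directions share the
    one-dimensional Taylor expansions. *)
Definition line (d : direction) (g : field) (t x y s : R) : R :=
  match d with
  | dir_t => g (t + s) x y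
  | dir_x => g t (x + s) y
  | dir_y => g t x (y + s)
  end.

Lemma line_0 (d : direction) (g : field) (t x y : R) :
  line d g t x y 0 = g t x y.
Proof. destruct d; simpl; now rewrite Rplus_0_r. Qed.

Definition partial_h (d : direction) (g : R -> field) : R -> field :=
  fun h => partial d (g h).

Lemma is_derive_line (d : direction) (g : field) (t x y s : R) :
  (forall t x y, 0 < t -> ex_partial d g t x y) ->
  0 < t -> (d = dir_t -> 0 <= s) ->
  is_derive (line d g t x y) s (line d (partial d g) t x y s).
Proof.
intros Hex Ht Hs.
assert (shift1 : forall c : R, is_derive (fun s : R => c + s) s 1).
{ intro c; auto_derive; trivial; ring. }
destruct d; simpl.
- assert (Hp : 0 < t + s) by (specialize (Hs eq_refl); lra).
  pose proof (Derive_correct _ _ (Hex (t + s) x y Hp)) as D.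
  evar_last; [exact (is_derive_comp _ _ _ _ _ D (shift1 t))|].
  exact (Rmult_1_l _).
- pose proof (Derive_correct _ _ (Hex t (x + s) y Ht)) as D.
  evar_last; [exact (is_derive_comp _ _ _ _ _ D (shift1 x))|].
  exact (Rmult_1_l _).
- pose proof (Derive_correct _ _ (Hex t x (y + s) Ht)) as D.
  evar_last; [exact (is_derive_comp _ _ _ _ _ D (shift1 y))|].
  exact (Rmult_1_l _).
Qed.

Definition differentiable (H : R) (d : direction) (g : R -> field) : Prop :=
  forall h t x y : R, 0 < h < H -> 0 < t -> ex_partial d (g h) t x y.

(** [Reg Q H k g]: the derivatives of [g] up to the order [k] exist and
    satisfy [Q].  The recursion peels off the innermost derivative, so that
    the Leibniz rule turns stability under products into an induction on
    [k]. *)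
Fixpoint Reg (Q : (R -> field) -> Prop) (H : R) (k : nat) (g : R -> field)
    : Prop :=
  match k with
  | O => Q g
  | S k' => Q g /\ forall d, differentiable H d g /\ Reg Q H k' (partial_h d g)
  end.

(** The two instances in use are the trivial property, for differentiability
    alone, and [bigO 0]. *)
Record growth (Q : (R -> field) -> Prop) (H : R) : Prop := {
  growth_agree : forall f g, agree H f g -> Q f -> Q g;
  growth_plus : forall f g, Q f -> Q g -> Q (fun h t x y => f h t x y + g h t x y);
  growth_mult : forall f g, Q f -> Q g -> Q (fun h t x y => f h t x y * g h t x y);
  growth_const : forall c, Q (fun _ _ _ _ => c)
}.

Lemma growth_any (H : R) : growth (fun _ => True) H.
Proof. split; trivial. Qed.

Lemma growth_bounded (H : R) : 0 < H -> growth (bigO 0) H.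
Proof.
intro HH; split.
- intros f g; now apply bigO_agree.
- intros f g; apply bigO_plus.
- intros f g; apply (bigO_mult 0 0).
- exact bigO_const.
Qed.

Lemma Reg_pred (Q : (R -> field) -> Prop) (H : R) (k : nat) (g : R -> field) :
  Reg Q H (S k) g -> Reg Q H k g.
Proof.
revert g; induction k as [|k IH]; intros g [Hg Hd]; [trivial|].
split; trivial. intro d; destruct (Hd d) as [D R']; split; trivial.
now apply IH.
Qed.

(** The derivatives at positive times only depend on the values at positive
    times because the half-space is open. *)
Lemma partial_agree (H : R) (d : direction) (f g : R -> field) :
  agree H f g -> agree H (partial_h d f) (partial_h d g).
Proof.
intros E h t x y Hh Ht.
destruct d; apply Derive_ext_loc.
- exists (mkposreal t Ht). intros s Hs. apply E; trivial.
  apply Rabs_lt_between' in Hs; simpl in Hs; lra.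
- exists (mkposreal 1 Rlt_0_1). intros s _. now apply E.
- exists (mkposreal 1 Rlt_0_1). intros s _. now apply E.
Qed.

Lemma differentiable_agree (H : R) (d : direction) (f g : R -> field) :
  agree H f g -> differentiable H d f -> differentiable H d g.
Proof.
intros E D h t x y Hh Ht. specialize (D h t x y Hh Ht).
destruct d; refine (ex_derive_ext_loc _ _ _ _ D).
- exists (mkposreal t Ht). intros s Hs. apply E; trivial.
  apply Rabs_lt_between' in Hs; simpl in Hs; lra.
- exists (mkposreal 1 Rlt_0_1). intros s _. now apply E.
- exists (mkposreal 1 Rlt_0_1). intros s _. now apply E.
Qed.

Lemma Reg_agree (Q : (R -> field) -> Prop) (H : R) (k : nat)
    (f g : R -> field) :
  growth Q H -> agree H f g -> Reg Q H k f -> Reg Q H k g.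
Proof.
intro G; revert f g; induction k as [|k IH]; intros f g E; simpl.
- now apply (growth_agree Q H G).
- intros [Hf Hd]; split; [now apply (growth_agree Q H G f)|].
  intro d; destruct (Hd d) as [D R']; split.
  + now apply (differentiable_agree H d f).
  + apply IH with (2 := R'). now apply partial_agree.
Qed.

Lemma differentiable_plus (H : R) (d : direction) (f g : R -> field) :
  differentiable H d f -> differentiable H d g ->
  differentiable H d (fun h t x y => f h t x y + g h t x y).
Proof.
intros Df Dg h t x y Hh Ht.
specialize (Df h t x y Hh Ht); specialize (Dg h t x y Hh Ht).
destruct d; exact (ex_derive_plus _ _ _ Df Dg).
Qed.

Lemma partial_plus (H : R) (d : direction) (f g : R -> field) :
  differentiable H d f -> differentiable H d g ->
  agree H (partial_h d (fun h t x y => f h t x y + g h t x y))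
    (fun h t x y => partial_h d f h t x y + partial_h d g h t x y).
Proof.
intros Df Dg h t x y Hh Ht.
specialize (Df h t x y Hh Ht); specialize (Dg h t x y Hh Ht).
destruct d; exact (Derive_plus _ _ _ Df Dg).
Qed.

Lemma differentiable_mult (H : R) (d : direction) (f g : R -> field) :
  differentiable H d f -> differentiable H d g ->
  differentiable H d (fun h t x y => f h t x y * g h t x y).
Proof.
intros Df Dg h t x y Hh Ht.
specialize (Df h t x y Hh Ht); specialize (Dg h t x y Hh Ht).
destruct d; apply ex_derive_mult; assumption.
Qed.

Lemma partial_mult (H : R) (d : direction) (f g : R -> field) :
  differentiable H d f -> differentiable H d g ->
  agree H (partial_h d (fun h t x y => f h t x y * g h t x y))
    (fun h t x y => partial_h d f h t x y * g h t x y
                    + f h t x y * partial_h d g h t x y).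
Proof.
intros Df Dg h t x y Hh Ht.
specialize (Df h t x y Hh Ht); specialize (Dg h t x y Hh Ht).
destruct d; exact (Derive_mult _ _ _ Df Dg).
Qed.

Lemma partial_const (d : direction) (c : R -> R) (h t x y : R) :
  partial_h d (fun h _ _ _ => c h) h t x y = 0.
Proof. destruct d; exact (Derive_const _ _). Qed.

Lemma differentiable_const (H : R) (d : direction) (c : R -> R) :
  differentiable H d (fun h _ _ _ => c h).
Proof. intros h t x y _ _. destruct d; exact (ex_derive_const _ _). Qed.

Lemma partial_scal (d : direction) (c : R) (g : field) (t x y : R) :
  partial d (fun t x y => c * g t x y) t x y = c * partial d g t x y.
Proof. destruct d; exact (Derive_scal _ _ _). Qed.

Lemma Reg_const (Q : (R -> field) -> Prop) (H : R) (k : nat) (c : R -> R) :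
  growth Q H -> Q (fun h _ _ _ => c h) -> Reg Q H k (fun h _ _ _ => c h).
Proof.
intro G; revert c; induction k as [|k IH]; intros c Qc; simpl; trivial.
split; trivial. intro d; split; [exact (differentiable_const H d c)|].
apply Reg_agree with (1 := G) (3 := IH (fun _ => 0) (growth_const Q H G 0)).
intros h t x y _ _. symmetry. exact (partial_const d c h t x y).
Qed.

Lemma Reg_plus (Q : (R -> field) -> Prop) (H : R) (k : nat) (f g : R -> field) :
  growth Q H -> Reg Q H k f -> Reg Q H k g ->
  Reg Q H k (fun h t x y => f h t x y + g h t x y).
Proof.
intro G; revert f g; induction k as [|k IH]; intros f g; simpl.
- apply (growth_plus Q H G).
- intros [Qf Df] [Qg Dg]; split; [now apply (growth_plus Q H G)|].
  intro d; destruct (Df d) as [df Rf], (Dg d) as [dg Rg]; split.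
  + now apply differentiable_plus.
  + apply Reg_agree with (1 := G) (3 := IH _ _ Rf Rg).
    intros h t x y Hh Ht; symmetry; now apply (partial_plus H).
Qed.

Lemma Reg_mult (Q : (R -> field) -> Prop) (H : R) (k : nat) (f g : R -> field) :
  growth Q H -> Reg Q H k f -> Reg Q H k g ->
  Reg Q H k (fun h t x y => f h t x y * g h t x y).
Proof.
intro G; revert f g; induction k as [|k IH]; intros f g.
- apply (growth_mult Q H G).
- intros Rf Rg; pose proof (Reg_pred Q H k f Rf) as Rf'.
  pose proof (Reg_pred Q H k g Rg) as Rg'.
  destruct Rf as [Qf Df], Rg as [Qg Dg].
  split; [now apply (growth_mult Q H G)|].
  intro d; destruct (Df d) as [df Rf], (Dg d) as [dg Rg]; split.
  + now apply differentiable_mult.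
  + apply Reg_agree with (f := fun h t x y =>
      partial_h d f h t x y * g h t x y + f h t x y * partial_h d g h t x y);
      trivial.
    * intros h t x y Hh Ht; symmetry; now apply (partial_mult H).
    * apply Reg_plus; auto.
Qed.

Definition nonvanishing (H : R) (g : R -> field) : Prop :=
  forall h t x y : R, 0 < h < H -> 0 < t -> g h t x y <> 0.

Lemma Derive_inv_prod (g : R -> R) (s : R) :
  ex_derive g s -> g s <> 0 ->
  Derive (fun u => / g u) s = -1 * (Derive g s * (/ g s * / g s)).
Proof.
intros D Hnz. rewrite Derive_inv by trivial. field; trivial.
Qed.

(** A bound on [1 / g] suffices for all its derivatives, which are products of
    powers of [1 / g] and of derivatives of [g]. *)
Lemma Reg_inv (Q : (R -> field) -> Prop) (H : R) (k : nat) (g : R -> field) :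
  growth Q H -> nonvanishing H g -> Q (fun h t x y => / g h t x y) ->
  Reg Q H k g -> Reg Q H k (fun h t x y => / g h t x y).
Proof.
intros G Hn Qi; induction k as [|k IH]; trivial.
intro Rg; pose proof (IH (Reg_pred Q H k g Rg)) as Ri.
destruct Rg as [_ Dg]; split; trivial.
intro d; destruct (Dg d) as [dg Rg]; split.
- intros h t x y Hh Ht; specialize (dg h t x y Hh Ht).
  pose proof (Hn h t x y Hh Ht) as Hnz.
  destruct d; exact (ex_derive_inv _ _ dg Hnz).
- apply Reg_agree with (f := fun h t x y =>
    -1 * (partial_h d g h t x y * (/ g h t x y * / g h t x y))); trivial.
  + intros h t x y Hh Ht; specialize (dg h t x y Hh Ht).
    pose proof (Hn h t x y Hh Ht) as Hnz.
    symmetry; destruct d; exact (Derive_inv_prod _ _ dg Hnz).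
  + repeat apply Reg_mult; trivial.
    exact (Reg_const Q H k (fun _ => -1) G (growth_const Q H G _)).
Qed.

Lemma is_derive_Rpower (g : R -> R) (gamma s : R) :
  ex_derive g s -> 0 < g s ->
  is_derive (fun u => Rpower (g u) gamma) s
    (gamma * (Rpower (g s) gamma * / g s * Derive g s)).
Proof.
intros D P.
replace (gamma * (Rpower (g s) gamma * / g s * Derive g s))
  with (Derive g s * (gamma * Rpower (g s) (gamma - 1))).
- apply (is_derive_comp (fun r => Rpower r gamma) g).
  + apply is_derive_Reals. now apply derivable_pt_lim_power.
  + now apply Derive_correct.
- unfold Rminus. rewrite Rpower_plus, Rpower_Ropp, Rpower_1 by trivial. ring.
Qed.

Lemma differentiable_Rpower (H gamma : R) (d : direction) (g : R -> field) :
  (forall h t x y, 0 < h < H -> 0 < t -> 0 < g h t x y) ->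
  differentiable H d g ->
  differentiable H d (fun h t x y => Rpower (g h t x y) gamma).
Proof.
intros P D h t x y Hh Ht; specialize (D h t x y Hh Ht); specialize (P h t x y Hh Ht).
destruct d; eexists; apply (is_derive_Rpower _ gamma _ D P).
Qed.

Lemma partial_Rpower (H gamma : R) (d : direction) (g : R -> field) :
  (forall h t x y, 0 < h < H -> 0 < t -> 0 < g h t x y) ->
  differentiable H d g ->
  agree H (partial_h d (fun h t x y => Rpower (g h t x y) gamma))
    (fun h t x y => gamma * (Rpower (g h t x y) gamma * / g h t x y
                             * partial_h d g h t x y)).
Proof.
intros P D h t x y Hh Ht; specialize (D h t x y Hh Ht); specialize (P h t x y Hh Ht).
destruct d; apply is_derive_unique; exact (is_derive_Rpower _ gamma _ D P).
Qed.

Lemma Reg_Rpower (Q : (R -> field) -> Prop) (H gamma : R) (k : nat)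
    (g : R -> field) :
  growth Q H -> (forall h t x y, 0 < h < H -> 0 < t -> 0 < g h t x y) ->
  Q (fun h t x y => / g h t x y) ->
  Q (fun h t x y => Rpower (g h t x y) gamma) ->
  Reg Q H k g -> Reg Q H k (fun h t x y => Rpower (g h t x y) gamma).
Proof.
intros G P Qi Qp; induction k as [|k IH]; trivial.
intro Rg. pose proof (Reg_pred Q H k g Rg) as Rg'. pose proof (IH Rg') as Rp.
destruct Rg as [_ Dg]; split; trivial.
intro d; destruct (Dg d) as [dg Rg]; split.
- now apply differentiable_Rpower.
- apply Reg_agree with (f := fun h t x y => gamma *
    (Rpower (g h t x y) gamma * / g h t x y * partial_h d g h t x y)); trivial.
  + intros h t x y Hh Ht; symmetry; now apply (partial_Rpower H).
  + repeat apply Reg_mult; trivial;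
      [exact (Reg_const Q H k (fun _ => gamma) G (growth_const Q H G _))|].
    apply Reg_inv; trivial. intros h t x y Hh Ht.
    apply Rgt_not_eq, P; trivial.
Qed.

Definition usmooth (H : R) (g : R -> field) : Prop :=
  forall k, Reg (bigO 0) H k g.

Lemma partials_app (ds : list direction) (d : direction) (g : field) :
  partials (ds ++ d :: nil) g = partials ds (partial d g).
Proof. induction ds as [|e ds IH]; simpl; [trivial|now rewrite IH]. Qed.

(** For families such as the remainder of the pressure, differentiability comes
    from the closure rules for each fixed step, while the bounds come from a
    hypothesis on the derivatives and not from bounds on the factors. *)
Lemma usmooth_of_bounds (H : R) (g : R -> field) :
  (forall k, Reg (fun _ => True) H k g) -> smooth_bigO 0 g -> usmooth H g.
Proof.
intros Rg Bg k; revert g Rg Bg; induction k as [|k IH]; intros g Rg Bg.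
- exact (Bg nil).
- split; [exact (Bg nil)|].
  intro d; split; [exact (proj1 (proj2 (Rg 1%nat) d))|].
  apply IH.
  + intro l; exact (proj2 (proj2 (Rg (S l)) d)).
  + intros ds a b r. unfold partial_h.
    pose proof (Bg (ds ++ d :: nil)%list a b r) as B. cbv beta in B |- *.
    intro Ha; destruct (B Ha) as [C [h0 [Hh0 B']]].
    exists C, h0; split; trivial. intros h t x y. rewrite <- partials_app.
    apply B'.
Qed.

Lemma Reg_of_smooth (H : R) (g : R -> field) :
  (forall h, 0 < h < H -> smooth (g h)) ->
  forall k, Reg (fun _ => True) H k g.
Proof.
intros S k; revert g S; induction k as [|k IH]; intros g S; simpl; trivial.
split; trivial. intro d; split.
- intros h t x y Hh Ht. exact (proj1 (S h Hh nil t x y Ht) d).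
- apply IH. intros h Hh ds t x y Ht. unfold partial_h.
  rewrite <- partials_app. now apply S.
Qed.

Lemma usmooth_bounded (H : R) (g : R -> field) : usmooth H g -> bigO 0 g.
Proof. intro S; exact (S 0%nat). Qed.

Lemma usmooth_differentiable (H : R) (d : direction) (g : R -> field) :
  usmooth H g -> differentiable H d g.
Proof. intro S; exact (proj1 (proj2 (S 1%nat) d)). Qed.

Lemma usmooth_partial (H : R) (d : direction) (g : R -> field) :
  usmooth H g -> usmooth H (partial_h d g).
Proof. intros S k; exact (proj2 (proj2 (S (Datatypes.S k)) d)). Qed.

Lemma usmooth_plus (H : R) (f g : R -> field) :
  0 < H -> usmooth H f -> usmooth H g ->
  usmooth H (fun h t x y => f h t x y + g h t x y).
Proof. intros HH Sf Sg k; apply Reg_plus; trivial. now apply growth_bounded. Qed.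

Lemma usmooth_mult (H : R) (f g : R -> field) :
  0 < H -> usmooth H f -> usmooth H g ->
  usmooth H (fun h t x y => f h t x y * g h t x y).
Proof. intros HH Sf Sg k; apply Reg_mult; trivial. now apply growth_bounded. Qed.

Lemma usmooth_scal (H c : R) (g : R -> field) :
  0 < H -> usmooth H g -> usmooth H (fun h t x y => c * g h t x y).
Proof.
intros HH Sg; apply usmooth_mult; trivial.
intro k; exact (Reg_const (bigO 0) H k (fun _ => c) (growth_bounded H HH)
  (bigO_const c)).
Qed.

(** * Taylor expansions on lines *)

Definition between (s z : R) : Prop := Rmin 0 s <= z <= Rmax 0 s.

Lemma between_Rabs (s z : R) : between s z -> Rabs z <= Rabs s.
Proof.
unfold between, Rmin, Rmax. destruct (Rle_dec 0 s); intro Hz.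
- rewrite !Rabs_pos_eq; lra.
- rewrite !Rabs_left1; lra.
Qed.

Lemma between_end (s : R) : between s s.
Proof. split; [apply Rmin_r|apply Rmax_r]. Qed.

Lemma taylor_step (f f' : R -> R) (M s : R) (k : nat) :
  0 <= M ->
  (forall z, between s z -> is_derive f z (f' z)) -> f 0 = 0 ->
  (forall z, between s z -> Rabs (f' z) <= M * Rabs z ^ k) ->
  forall z, between s z -> Rabs (f z) <= M * Rabs z ^ S k.
Proof.
intros HM D F0 B z Hz.
assert (Sub : forall y, between z y -> between s y).
{ intros y Hy; revert Hz Hy; unfold between, Rmin, Rmax.
  repeat destruct (Rle_dec _ _); lra. }
destruct (MVT_gen f 0 z f') as [c [Hc E]].
- intros y Hy; apply D, Sub; unfold between; lra.
- intros y Hy; apply continuity_pt_filterlim.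
  apply (ex_derive_continuous f y). eexists; now apply D, Sub.
- rewrite F0, !Rminus_0_r in E. rewrite E, Rabs_mult.
  replace (M * Rabs z ^ S k) with (M * Rabs z ^ k * Rabs z) by (simpl; ring).
  apply Rmult_le_compat_r; [apply Rabs_pos|].
  apply Rle_trans with (1 := B c (Sub c Hc)).
  apply Rmult_le_compat_l; trivial. apply pow_incr.
  split; [apply Rabs_pos|now apply between_Rabs].
Qed.

(** Taylor's formula with a crude constant in the remainder, by integrating
    the bound on the last derivative as many times as needed. *)
Lemma taylor1 (f f1 : R -> R) (M s : R) :
  0 <= M ->
  (forall z, between s z -> is_derive f z (f1 z)) ->
  (forall z, between s z -> Rabs (f1 z) <= M) ->
  forall z, between s z -> Rabs (f z - f 0) <= M * Rabs z.
Proof.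
intros HM D B z Hz. rewrite <- (pow_1 (Rabs z)).
apply (taylor_step (fun z => f z - f 0) f1 M s 0); trivial; try ring.
- intros y Hy. evar_last.
  + apply (is_derive_minus (V := R_NormedModule));
      [now apply D|exact (is_derive_const _ _)].
  + unfold minus, plus, opp, zero; simpl; ring.
- intros y Hy. simpl; rewrite Rmult_1_r. now apply B.
Qed.

Lemma taylor2 (f f1 f2 : R -> R) (M s : R) :
  0 <= M ->
  (forall z, between s z -> is_derive f z (f1 z)) ->
  (forall z, between s z -> is_derive f1 z (f2 z)) ->
  (forall z, between s z -> Rabs (f2 z) <= M) ->
  forall z, between s z -> Rabs (f z - (f 0 + z * f1 0)) <= M * Rabs z ^ 2.
Proof.
intros HM D D1 B z Hz.
apply (taylor_step (fun z => f z - (f 0 + z * f1 0))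
         (fun z => f1 z - f1 0) M s 1); trivial; try ring.
- intros y Hy. pose proof (D y Hy) as Dy. evar_last.
  + apply (is_derive_minus (V := R_NormedModule)); [exact Dy|].
    apply (is_derive_plus (V := R_NormedModule)); [exact (is_derive_const _ _)|].
    apply (is_derive_scal_l (V := R_NormedModule)). exact (is_derive_id _).
  + unfold minus, plus, opp, zero, one, scal, mult; simpl.
    unfold mult; simpl; ring.
- intros y Hy. rewrite pow_1. now apply taylor1 with f2 s.
Qed.

Lemma taylor3 (f f1 f2 f3 : R -> R) (M s : R) :
  0 <= M ->
  (forall z, between s z -> is_derive f z (f1 z)) ->
  (forall z, between s z -> is_derive f1 z (f2 z)) ->
  (forall z, between s z -> is_derive f2 z (f3 z)) ->
  (forall z, between s z -> Rabs (f3 z) <= M) ->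
  forall z, between s z ->
  Rabs (f z - (f 0 + z * f1 0 + z ^ 2 * (f2 0 / 2))) <= M * Rabs z ^ 3.
Proof.
intros HM D D1 D2 B z Hz.
apply (taylor_step (fun z => f z - (f 0 + z * f1 0 + z ^ 2 * (f2 0 / 2)))
         (fun z => f1 z - (f1 0 + z * f2 0)) M s 2); trivial; try ring.
- intros y Hy. pose proof (D y Hy) as Dy. evar_last.
  + apply (is_derive_minus (V := R_NormedModule)); [exact Dy|].
    apply (is_derive_ext (fun u => f 0 + u * f1 0 + u ^ 2 * (f2 0 / 2)));
      [trivial|].
    auto_derive; [trivial|reflexivity].
  + unfold minus, plus, opp; simpl. field.
- intros y Hy. now apply taylor2 with f3 s.
Qed.

Lemma taylor4 (f f1 f2 f3 f4 : R -> R) (M s : R) :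
  0 <= M ->
  (forall z, between s z -> is_derive f z (f1 z)) ->
  (forall z, between s z -> is_derive f1 z (f2 z)) ->
  (forall z, between s z -> is_derive f2 z (f3 z)) ->
  (forall z, between s z -> is_derive f3 z (f4 z)) ->
  (forall z, between s z -> Rabs (f4 z) <= M) ->
  forall z, between s z ->
  Rabs (f z - (f 0 + z * f1 0 + z ^ 2 * (f2 0 / 2) + z ^ 3 * (f3 0 / 6)))
    <= M * Rabs z ^ 4.
Proof.
intros HM D D1 D2 D3 B z Hz.
apply (taylor_step
         (fun z => f z - (f 0 + z * f1 0 + z ^ 2 * (f2 0 / 2)
                          + z ^ 3 * (f3 0 / 6)))
         (fun z => f1 z - (f1 0 + z * f2 0 + z ^ 2 * (f3 0 / 2))) M s 3);
  trivial; try ring.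
- intros y Hy. pose proof (D y Hy) as Dy. evar_last.
  + apply (is_derive_minus (V := R_NormedModule)); [exact Dy|].
    apply (is_derive_ext (fun u => f 0 + u * f1 0 + u ^ 2 * (f2 0 / 2)
                                   + u ^ 3 * (f3 0 / 6))); [trivial|].
    auto_derive; [trivial|reflexivity].
  + unfold minus, plus, opp; simpl. field.
- intros y Hy. now apply taylor3 with f4 s.
Qed.

Lemma between_sign (s z : R) : 0 <= s -> between s z -> 0 <= z.
Proof. intros Hs [Hz _]. rewrite Rmin_left in Hz; lra. Qed.

(** Estimates remain valid after a move of length at most 1 along a line,
    forwards if in time, since compact sets can be enlarged. *)
Lemma bigO_line (d : direction) (k : nat) (g : R -> field) (a b r : R) :
  bigO k g -> 0 < a -> exists C h0, 0 <= C /\ 0 < h0 /\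
  forall h t x y s, 0 < h < h0 -> a <= t <= b -> Rabs x <= r -> Rabs y <= r ->
    Rabs s <= 1 -> (d = dir_t -> 0 <= s) ->
    Rabs (line d (g h) t x y s) <= C * h ^ k.
Proof.
intros Og Ha.
destruct (Og a (b + 1) (r + 1) Ha) as [C [h0 [Hh0 B]]].
exists (Rabs C), h0. split; [apply Rabs_pos|split; trivial].
intros h t x y s Hh Ht Hx Hy Hs Hd.
assert (Hk : 0 <= h ^ k) by (apply pow_le; lra).
apply Rle_trans with (C * h ^ k);
  [|apply Rmult_le_compat_r; [trivial|apply Rle_abs]].
assert (Tri : forall u, Rabs u <= r -> Rabs (u + s) <= r + 1).
{ intros u Hu. apply Rle_trans with (1 := Rabs_triang _ _). lra. }
pose proof (Rle_abs s).
destruct d; simpl; apply B; trivial; try lra; try (now apply Tri).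
specialize (Hd eq_refl); lra.
Qed.

Lemma line_derivative (H : R) (d : direction) (g : R -> field) (h t x y s z : R) :
  usmooth H g -> 0 < h < H -> 0 < t -> (d = dir_t -> 0 <= s) -> between s z ->
  is_derive (line d (g h) t x y) z (line d (partial_h d g h) t x y z).
Proof.
intros Sg Hh Ht Hs Hz. apply is_derive_line; trivial.
- intros t' x' y' Ht'. now apply (usmooth_differentiable H d g Sg).
- intro E; apply between_sign with s; auto.
Qed.

(** * Grid functions *)

(** Indices are the step, the time and the two space coordinates.  Unlike
    samples of fields, the distribution functions are only defined on the grid,
    with no smooth extension. *)
Definition grid_family := R -> nat -> Z -> Z -> R.

Definition gridO (mu : R) (k : nat) (F : grid_family) : Prop :=
  forall a b r : R, 0 < a ->
  exists C h0 : R, 0 < h0 /\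
    forall (h : R) (n : nat) (i j : Z), 0 < h < h0 ->
      a <= time_at mu h n <= b ->
      Rabs (space_at h i) <= r -> Rabs (space_at h j) <= r ->
      Rabs (F h n i j) <= C * h ^ k.

Lemma gridO_ext (mu H : R) (k : nat) (F G : grid_family) :
  0 < H ->
  (forall h n i j, 0 < h < H -> F h n i j = G h n i j) ->
  gridO mu k F -> gridO mu k G.
Proof.
intros HH E OF a b r Ha.
destruct (OF a b r Ha) as [C [h0 [Hh0 B]]].
exists C, (Rmin h0 H); split; [now apply Rmin_pos|].
intros h n i j [Hh Hm] Ht Hx Hy.
assert (h < h0) by (apply Rlt_le_trans with (1 := Hm); apply Rmin_l).
assert (h < H) by (apply Rlt_le_trans with (1 := Hm); apply Rmin_r).
rewrite <- E by lra. apply B; trivial; lra.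
Qed.

Lemma gridO_plus (mu : R) (k : nat) (F G : grid_family) :
  gridO mu k F -> gridO mu k G ->
  gridO mu k (fun h n i j => F h n i j + G h n i j).
Proof.
intros OF OG a b r Ha.
destruct (OF a b r Ha) as [C [h0 [Hh0 B]]].
destruct (OG a b r Ha) as [C' [h0' [Hh0' B']]].
exists (C + C'), (Rmin h0 h0'); split; [now apply Rmin_pos|].
intros h n i j [Hh Hm] Ht Hx Hy.
assert (h < h0) by (apply Rlt_le_trans with (1 := Hm); apply Rmin_l).
assert (h < h0') by (apply Rlt_le_trans with (1 := Hm); apply Rmin_r).
apply Rle_trans with (1 := Rabs_triang _ _).
rewrite Rmult_plus_distr_r.
apply Rplus_le_compat; [apply B | apply B']; trivial; lra.
Qed.

Lemma gridO_hmul (mu c : R) (k l : nat) (F : grid_family) :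
  gridO mu l F -> gridO mu (k + l) (fun h n i j => c * h ^ k * F h n i j).
Proof.
intros OF a b r Ha.
destruct (OF a b r Ha) as [C [h0 [Hh0 B]]].
exists (Rabs c * C), h0; split; trivial.
intros h n i j Hh Ht Hx Hy. assert (0 <= h ^ k) by (apply pow_le; lra).
rewrite !Rabs_mult, (Rabs_pos_eq (h ^ k)), pow_add by trivial.
replace (Rabs c * C * (h ^ k * h ^ l)) with (Rabs c * h ^ k * (C * h ^ l)) by ring.
apply Rmult_le_compat_l; [apply Rmult_le_pos; trivial; apply Rabs_pos|].
now apply B.
Qed.

Lemma gridO_scal (mu c : R) (k : nat) (F : grid_family) :
  gridO mu k F -> gridO mu k (fun h n i j => c * F h n i j).
Proof.
intro OF. apply gridO_ext with 1 (fun h n i j => c * h ^ 0 * F h n i j);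
  [lra| |exact (gridO_hmul mu c 0 k F OF)].
intros; simpl; ring.
Qed.

Lemma time_at_S (mu h : R) (n : nat) :
  time_at mu h (S n) = time_at mu h n + h ^ 2 / mu.
Proof. unfold time_at. rewrite S_INR. ring. Qed.

Lemma space_at_plus (h : R) (i e : Z) :
  space_at h (i + e) = space_at h i + h * IZR e.
Proof. unfold space_at. rewrite plus_IZR. ring. Qed.

(** Steps small enough for a move to a neighbouring grid point, in time or in
    space, to have length at most 1. *)
Definition small_step (mu : R) : R := Rmin 1 mu.

Lemma small_step_pos (mu : R) : 0 < mu -> 0 < small_step mu.
Proof. intro; apply Rmin_pos; lra. Qed.

Lemma small_step_1 (mu h : R) : h < small_step mu -> h < 1.
Proof. intro Hh; apply Rlt_le_trans with (1 := Hh); apply Rmin_l. Qed.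

Lemma small_step_dt (mu h : R) :
  0 < mu -> 0 < h < small_step mu -> 0 < h ^ 2 / mu <= h.
Proof.
intros Hmu [Hh Hs]. pose proof (small_step_1 mu h Hs).
assert (h < mu) by (apply Rlt_le_trans with (1 := Hs); apply Rmin_r).
split; [apply Rdiv_lt_0_compat; trivial; apply pow_lt; lra|].
apply Rmult_le_reg_r with mu; trivial.
replace (h ^ 2 / mu * mu) with (h * h) by (field; lra). nra.
Qed.

Definition next (F : grid_family) : grid_family := fun h n => F h (S n).

Definition neighbour (d : direction) (e : Z) (F : grid_family) : grid_family :=
  fun h n i j =>
    match d with
    | dir_t => F h n i j
    | dir_x => F h n (i + e)%Z j
    | dir_y => F h n i (j + e)%Z
    end.

Lemma gridO_next (mu : R) (k : nat) (F : grid_family) :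
  0 < mu -> gridO mu k F -> gridO mu k (next F).
Proof.
intros Hmu OF a b r Ha.
destruct (OF a (b + 1) r Ha) as [C [h0 [Hh0 B]]].
exists C, (Rmin h0 (small_step mu)).
split; [apply Rmin_pos; [trivial|now apply small_step_pos]|].
intros h n i j [Hh Hm] Ht Hx Hy.
assert (h < h0) by (apply Rlt_le_trans with (1 := Hm); apply Rmin_l).
assert (Hs : h < small_step mu) by (apply Rlt_le_trans with (1 := Hm); apply Rmin_r).
pose proof (small_step_1 mu h Hs).
pose proof (small_step_dt mu h Hmu (conj Hh Hs)).
apply B; trivial; try lra. rewrite time_at_S. lra.
Qed.

Lemma gridO_shift (mu : R) (d : direction) (e : Z) (k : nat) (F : grid_family) :
  (e = 1 \/ e = -1)%Z -> gridO mu k F -> gridO mu k (neighbour d e F).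
Proof.
intros He OF a b r Ha.
destruct (OF a b (r + 1) Ha) as [C [h0 [Hh0 B]]].
exists C, (Rmin h0 1). split; [apply Rmin_pos; lra|].
intros h n i j [Hh Hm] Ht Hx Hy.
assert (h < h0) by (apply Rlt_le_trans with (1 := Hm); apply Rmin_l).
assert (h < 1) by (apply Rlt_le_trans with (1 := Hm); apply Rmin_r).
assert (Mv : forall i, Rabs (space_at h i) <= r ->
               Rabs (space_at h (i + e)) <= r + 1).
{ intros i' Hi. rewrite space_at_plus.
  apply Rle_trans with (1 := Rabs_triang _ _). apply Rplus_le_compat; trivial.
  destruct He; subst e; [rewrite Rmult_1_r|
    replace (h * IZR (-1)) with (- h) by (simpl; lra); rewrite Rabs_Ropp];
    rewrite Rabs_pos_eq; lra. }
destruct d; simpl; apply B; trivial; try lra; now apply Mv.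
Qed.

Definition sample (mu : R) (g : R -> field) : grid_family :=
  fun h n i j => g h (time_at mu h n) (space_at h i) (space_at h j).

Lemma gridO_sample (mu : R) (k : nat) (g : R -> field) :
  bigO k g -> gridO mu k (sample mu g).
Proof.
intros Og a b r Ha.
destruct (Og a b r Ha) as [C [h0 [Hh0 B]]].
exists C, h0; split; trivial. intros; now apply B.
Qed.

Lemma sample_next (mu : R) (g : R -> field) (h : R) (n : nat) (i j : Z) :
  next (sample mu g) h n i j
  = line dir_t (g h) (time_at mu h n) (space_at h i) (space_at h j) (h ^ 2 / mu).
Proof. unfold next, sample. now rewrite time_at_S. Qed.

Lemma sample_shift (mu : R) (d : direction) (e : Z) (g : R -> field) (h : R)
    (n : nat) (i j : Z) :
  d <> dir_t ->
  neighbour d e (sample mu g) h n i j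
  = line d (g h) (time_at mu h n) (space_at h i) (space_at h j) (h * IZR e).
Proof.
intro Hd. destruct d; [now destruct Hd| |]; unfold neighbour, sample; simpl;
  now rewrite space_at_plus.
Qed.

Lemma expand_next (mu H : R) (g : R -> field) :
  0 < mu -> 0 < H -> usmooth H g ->
  gridO mu 4 (fun h n i j => next (sample mu g) h n i j
    - (sample mu g h n i j + h ^ 2 / mu * sample mu (partial_h dir_t g) h n i j)).
Proof.
intros Hmu HH Sg a b r Ha.
destruct (bigO_line dir_t 0 (partial_h dir_t (partial_h dir_t g)) a b r)
  as [C [h0 [HC [Hh0 B]]]]; trivial.
{ apply (usmooth_bounded H). now repeat apply usmooth_partial. }
exists (C / mu ^ 2), (Rmin (Rmin h0 H) (small_step mu)).
split; [apply Rmin_pos; [now apply Rmin_pos|now apply small_step_pos]|].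
intros h n i j [Hh Hm] Ht Hx Hy.
apply Rmin_Rgt_l in Hm; destruct Hm as [Hm Hs].
apply Rmin_Rgt_l in Hm; destruct Hm as [Hm HhH].
pose proof (small_step_1 mu h Hs).
pose proof (small_step_dt mu h Hmu (conj Hh Hs)) as Hdt.
rewrite sample_next. unfold sample.
rewrite <- (line_0 dir_t (g h)), <- (line_0 dir_t (partial_h dir_t g h)).
set (s := h ^ 2 / mu) in *.
replace (C / mu ^ 2 * h ^ 4) with (C * Rabs s ^ 2)
  by (rewrite Rabs_pos_eq by lra; unfold s; field; lra).
assert (Hs0 : dir_t = dir_t -> 0 <= s) by (intros; lra).
apply taylor2 with (line dir_t (partial_h dir_t (partial_h dir_t g) h)
  (time_at mu h n) (space_at h i) (space_at h j)) s; trivial.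
- intros z Hz. apply line_derivative with H s; trivial; lra.
- intros z Hz. apply line_derivative with H s; trivial; try lra.
  now apply usmooth_partial.
- intros z Hz. rewrite <- (Rmult_1_r C). apply B; trivial; try lra.
  + apply Rle_trans with (1 := between_Rabs s z Hz). rewrite Rabs_pos_eq; lra.
  + intros _; apply between_sign with s; trivial; lra.
- apply between_end.
Qed.

(** The odd terms of the two expansions cancel. *)
Lemma expand_sum (mu H : R) (d : direction) (g : R -> field) :
  0 < mu -> 0 < H -> d <> dir_t -> usmooth H g ->
  gridO mu 4 (fun h n i j =>
    neighbour d 1 (sample mu g) h n i j + neighbour d (-1) (sample mu g) h n i j
    - (2 * sample mu g h n i j
       + h ^ 2 * sample mu (partial_h d (partial_h d g)) h n i j)).
Proof.
intros Hmu HH Hd Sg a b r Ha.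
set (g1 := partial_h d g). set (g2 := partial_h d g1).
set (g3 := partial_h d g2). set (g4 := partial_h d g3).
assert (S1 : usmooth H g1) by now apply usmooth_partial.
assert (S2 : usmooth H g2) by now apply usmooth_partial.
assert (S3 : usmooth H g3) by now apply usmooth_partial.
assert (S4 : usmooth H g4) by now apply usmooth_partial.
destruct (bigO_line d 0 g4 a b r) as [C [h0 [HC [Hh0 B]]]]; trivial.
{ now apply (usmooth_bounded H). }
exists (2 * C), (Rmin (Rmin h0 H) 1).
split; [repeat apply Rmin_pos; lra|].
intros h n i j [Hh Hm] Ht Hx Hy.
apply Rmin_Rgt_l in Hm; destruct Hm as [Hm Hh1].
apply Rmin_Rgt_l in Hm; destruct Hm as [Hm HhH].
rewrite !sample_shift by trivial. unfold sample.
set (t := time_at mu h n) in *. set (x := space_at h i) in *.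
set (y := space_at h j) in *.
assert (T : forall s, Rabs s = h ->
  Rabs (line d (g h) t x y s - (line d (g h) t x y 0 + s * line d (g1 h) t x y 0
    + s ^ 2 * (line d (g2 h) t x y 0 / 2) + s ^ 3 * (line d (g3 h) t x y 0 / 6)))
  <= C * h ^ 4).
{ intros s Hs. replace (h ^ 4) with (Rabs s ^ 4) by now rewrite Hs.
  assert (Ds : d = dir_t -> 0 <= s) by (intro E; now destruct Hd).
  apply taylor4 with (line d (g4 h) t x y) s; trivial.
  - intros z Hz. apply line_derivative with H s; trivial; lra.
  - intros z Hz. apply line_derivative with H s; trivial; lra.
  - intros z Hz. apply line_derivative with H s; trivial; lra.
  - intros z Hz. apply line_derivative with H s; trivial; lra.
  - intros z Hz. rewrite <- (Rmult_1_r C). apply B; trivial; try lra.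
    + apply Rle_trans with (1 := between_Rabs s z Hz). lra.
    + intros E; now destruct Hd.
  - apply between_end. }
pose proof (T h (Rabs_pos_eq h ltac:(lra))) as T1.
pose proof (T (- h) ltac:(rewrite Rabs_Ropp; apply Rabs_pos_eq; lra)) as T2.
rewrite !line_0 in T1, T2.
replace (h * IZR 1) with h by (simpl; ring).
replace (h * IZR (-1)) with (- h) by (simpl; lra).
replace (2 * C * h ^ 4) with (C * h ^ 4 + C * h ^ 4) by ring.
refine (Rle_trans _ _ _ _ (Rplus_le_compat _ _ _ _ T1 T2)).
refine (Rle_trans _ _ _ _ (Rabs_triang _ _)).
apply Req_le, f_equal. field.
Qed.

Lemma expand_difference (mu H : R) (d : direction) (g : R -> field) :
  0 < mu -> 0 < H -> d <> dir_t -> usmooth H g ->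
  gridO mu 3 (fun h n i j =>
    neighbour d 1 (sample mu g) h n i j - neighbour d (-1) (sample mu g) h n i j
    - 2 * h * sample mu (partial_h d g) h n i j).
Proof.
intros Hmu HH Hd Sg a b r Ha.
set (g1 := partial_h d g). set (g2 := partial_h d g1).
set (g3 := partial_h d g2).
assert (S1 : usmooth H g1) by now apply usmooth_partial.
assert (S2 : usmooth H g2) by now apply usmooth_partial.
assert (S3 : usmooth H g3) by now apply usmooth_partial.
destruct (bigO_line d 0 g3 a b r) as [C [h0 [HC [Hh0 B]]]]; trivial.
{ now apply (usmooth_bounded H). }
exists (2 * C), (Rmin (Rmin h0 H) 1).
split; [repeat apply Rmin_pos; lra|].
intros h n i j [Hh Hm] Ht Hx Hy.
apply Rmin_Rgt_l in Hm; destruct Hm as [Hm Hh1].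
apply Rmin_Rgt_l in Hm; destruct Hm as [Hm HhH].
rewrite !sample_shift by trivial. unfold sample.
set (t := time_at mu h n) in *. set (x := space_at h i) in *.
set (y := space_at h j) in *.
assert (T : forall s, Rabs s = h ->
  Rabs (line d (g h) t x y s - (line d (g h) t x y 0 + s * line d (g1 h) t x y 0
    + s ^ 2 * (line d (g2 h) t x y 0 / 2))) <= C * h ^ 3).
{ intros s Hs. replace (h ^ 3) with (Rabs s ^ 3) by now rewrite Hs.
  assert (Ds : d = dir_t -> 0 <= s) by (intro E; now destruct Hd).
  apply taylor3 with (line d (g3 h) t x y) s; trivial.
  - intros z Hz. apply line_derivative with H s; trivial; lra.
  - intros z Hz. apply line_derivative with H s; trivial; lra.
  - intros z Hz. apply line_derivative with H s; trivial; lra.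
  - intros z Hz. rewrite <- (Rmult_1_r C). apply B; trivial; try lra.
    + apply Rle_trans with (1 := between_Rabs s z Hz). lra.
    + intros E; now destruct Hd.
  - apply between_end. }
pose proof (T h (Rabs_pos_eq h ltac:(lra))) as T1.
pose proof (T (- h) ltac:(rewrite Rabs_Ropp; apply Rabs_pos_eq; lra)) as T2.
rewrite !line_0 in T1, T2. rewrite Rabs_minus_sym in T2.
replace (h * IZR 1) with h by (simpl; ring).
replace (h * IZR (-1)) with (- h) by (simpl; lra).
replace (2 * C * h ^ 3) with (C * h ^ 3 + C * h ^ 3) by ring.
refine (Rle_trans _ _ _ _ (Rplus_le_compat _ _ _ _ T1 T2)).
refine (Rle_trans _ _ _ _ (Rabs_triang _ _)).
apply Req_le, f_equal. field.
Qed.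

(** * From the grid to the continuum *)

(** Linear interpolation: the combination of the two expansions at an interior
    point that has the values at the ends as weighted mean eliminates the
    first derivative. *)
Lemma interpolation_bound (f f1 f2 : R -> R) (M K s1 s2 : R) :
  0 <= M -> 0 <= s1 -> 0 <= s2 -> 0 < s1 + s2 ->
  (forall z, is_derive f z (f1 z)) -> (forall z, is_derive f1 z (f2 z)) ->
  (forall z, Rabs z <= s1 + s2 -> Rabs (f2 z) <= M) ->
  Rabs (f (- s1)) <= K -> Rabs (f s2) <= K ->
  Rabs (f 0) <= K + M * (s1 + s2) ^ 2.
Proof.
intros HM H1 H2 H12 D D1 B B1 B2.
assert (T : forall s, Rabs s <= s1 + s2 ->
  Rabs (f s - (f 0 + s * f1 0)) <= M * Rabs s ^ 2).
{ intros s Hs. apply taylor2 with f2 s; trivial.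
  - intros z Hz. apply B. apply Rle_trans with (2 := Hs).
    now apply between_Rabs.
  - apply between_end. }
pose proof (T (- s1) ltac:(rewrite Rabs_Ropp, Rabs_pos_eq; lra)) as T1.
pose proof (T s2 ltac:(rewrite Rabs_pos_eq; lra)) as T2.
rewrite Rabs_Ropp, (Rabs_pos_eq s1) in T1 by trivial.
rewrite (Rabs_pos_eq s2) in T2 by trivial.
apply Rabs_le_between in T1, T2, B1, B2. apply Rabs_le_between.
assert (Q1 : s1 ^ 2 <= (s1 + s2) ^ 2) by nra.
assert (Q2 : s2 ^ 2 <= (s1 + s2) ^ 2) by nra.
assert (N1 : M * s1 ^ 2 <= M * (s1 + s2) ^ 2) by (apply Rmult_le_compat_l; trivial).
assert (N2 : M * s2 ^ 2 <= M * (s1 + s2) ^ 2) by (apply Rmult_le_compat_l; trivial).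
set (N := M * (s1 + s2) ^ 2) in *.
split; apply Rmult_le_reg_l with (s1 + s2); trivial; nra.
Qed.

Lemma grid_cell (h x : R) : 0 < h ->
  exists i : Z, space_at h i <= x <= space_at h (i + 1).
Proof.
intro Hh. set (z := x / h - 1 / 2).
destruct (archimed z) as [U1 U2].
exists (up z - 1)%Z. replace (up z - 1 + 1)%Z with (up z) by lia.
unfold space_at. rewrite minus_IZR.
replace x with (h * (z + 1 / 2)) at 1 2 by (unfold z; field; lra).
split; apply Rmult_le_compat_l; lra.
Qed.

(** Off the grid in space, a bound of order 2 survives linear interpolation;
    in time the mesh size is itself of order 2 and a Lipschitz bound
    suffices. *)
Lemma bigO_of_grid (mu H : R) (g : R -> field) :
  0 < mu -> 0 < H -> usmooth H g -> gridO mu 2 (sample mu g) -> bigO 2 g.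
Proof.
intros Hmu HH Sg Og a b r Ha.
assert (Sd : forall d, usmooth H (partial_h d g))
  by (intro; now apply usmooth_partial).
assert (Sdd : forall d, usmooth H (partial_h d (partial_h d g)))
  by (intro; now apply usmooth_partial).
destruct (Og (a / 2) b (r + 1)) as [C0 [h0 [Hh0 B0]]]; [lra|].
destruct (bigO_line dir_x 0 _ (a / 2) b (r + 1) (usmooth_bounded _ _ (Sdd dir_x)))
  as [Cx [hx [HCx [Hhx Bx]]]]; [lra|].
destruct (bigO_line dir_y 0 _ (a / 2) b (r + 1) (usmooth_bounded _ _ (Sdd dir_y)))
  as [Cy [hy [HCy [Hhy By]]]]; [lra|].
destruct (bigO_line dir_t 0 _ (a / 2) b r (usmooth_bounded _ _ (Sd dir_t)))
  as [Ct [ht [HCt [Hht Bt]]]]; [lra|].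
exists (C0 + Cy + Cx + Ct / mu),
  (Rmin (Rmin (Rmin h0 H) (Rmin hx hy)) (Rmin (Rmin ht (a / 2)) (small_step mu))).
split.
{ pose proof (small_step_pos mu Hmu).
  repeat (apply Rmin_pos; trivial); lra. }
intros h t x y [Hh Hm] Ht Hx Hy.
apply Rmin_Rgt_l in Hm; destruct Hm as [Hm Hm'].
apply Rmin_Rgt_l in Hm; destruct Hm as [Hm Hm''].
apply Rmin_Rgt_l in Hm; destruct Hm as [Hm0 HmH].
apply Rmin_Rgt_l in Hm''; destruct Hm'' as [Hmx Hmy].
apply Rmin_Rgt_l in Hm'; destruct Hm' as [Hm' Hms].
apply Rmin_Rgt_l in Hm'; destruct Hm' as [Hmt Hma].
pose proof (small_step_1 mu h Hms) as Hh1.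
pose proof (small_step_dt mu h Hmu (conj Hh Hms)) as Hdt.
apply Rabs_le_between in Hx, Hy.
destruct (nfloor_ex (t / (h ^ 2 / mu))) as [n Hn].
{ apply Rlt_le, Rdiv_lt_0_compat; lra. }
assert (Htn : time_at mu h n <= t < time_at mu h n + h ^ 2 / mu).
{ unfold time_at.
  replace t with (t / (h ^ 2 / mu) * (h ^ 2 / mu)) by (field; split; lra).
  split; [apply Rmult_le_compat_r; lra|].
  replace (INR n * (h ^ 2 / mu) + h ^ 2 / mu)
    with ((INR n + 1) * (h ^ 2 / mu)) by ring.
  apply Rmult_lt_compat_r; lra. }
set (t0 := time_at mu h n) in *.
assert (Ht0 : a / 2 <= t0 <= b) by lra.
assert (Step_y : forall i, Rabs (space_at h i) <= r + 1 ->
  Rabs (g h t0 (space_at h i) y) <= C0 * h ^ 2 + Cy * h ^ 2).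
{ intros i Hi. destruct (grid_cell h y Hh) as [j Hj].
  pose proof (space_at_plus h j 1) as Ej. rewrite Rmult_1_r in Ej.
  set (l := line dir_y (g h) t0 (space_at h i) y).
  replace (g h t0 (space_at h i) y) with (l 0) by apply line_0.
  replace h with ((y - space_at h j) + (space_at h (j + 1) - y)) at 2 by lra.
  apply interpolation_bound with
    (line dir_y (partial_h dir_y g h) t0 (space_at h i) y)
    (line dir_y (partial_h dir_y (partial_h dir_y g) h) t0 (space_at h i) y);
    trivial; try lra.
  - intro z. apply line_derivative with H z; trivial; try lra;
      [discriminate|apply between_end].
  - intro z. apply line_derivative with H z; trivial; try lra;
      [discriminate|apply between_end].
  - intros z Hz. rewrite <- (Rmult_1_r Cy).
    apply By; trivial; try lra; [apply Rabs_le_between; lra|discriminate].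
  - unfold l; simpl. replace (y + - (y - space_at h j)) with (space_at h j) by ring.
    apply B0; trivial; [lra|apply Rabs_le_between; lra].
  - unfold l; simpl. replace (y + (space_at h (j + 1) - y))
      with (space_at h (j + 1)) by ring.
    apply B0; trivial; [lra|apply Rabs_le_between; lra]. }
assert (Step_x : Rabs (g h t0 x y) <= C0 * h ^ 2 + Cy * h ^ 2 + Cx * h ^ 2).
{ destruct (grid_cell h x Hh) as [i Hi].
  pose proof (space_at_plus h i 1) as Ei. rewrite Rmult_1_r in Ei.
  set (l := line dir_x (g h) t0 x y).
  replace (g h t0 x y) with (l 0) by apply line_0.
  replace h with ((x - space_at h i) + (space_at h (i + 1) - x)) at 3 by lra.
  apply interpolation_bound with
    (line dir_x (partial_h dir_x g h) t0 x y)
    (line dir_x (partial_h dir_x (partial_h dir_x g) h) t0 x y);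
    trivial; try lra.
  - intro z. apply line_derivative with H z; trivial; try lra;
      [discriminate|apply between_end].
  - intro z. apply line_derivative with H z; trivial; try lra;
      [discriminate|apply between_end].
  - intros z Hz. rewrite <- (Rmult_1_r Cx).
    apply Bx; trivial; try lra; try discriminate; apply Rabs_le_between; lra.
  - unfold l; simpl. replace (x + - (x - space_at h i)) with (space_at h i) by ring.
    apply Step_y, Rabs_le_between; lra.
  - unfold l; simpl. replace (x + (space_at h (i + 1) - x))
      with (space_at h (i + 1)) by ring.
    apply Step_y, Rabs_le_between; lra. }
assert (Step_t : Rabs (g h t x y - g h t0 x y) <= Ct / mu * h ^ 2).
{ set (l := line dir_t (g h) t0 x y).
  replace (g h t0 x y) with (l 0) by apply line_0.
  replace (g h t x y) with (l (t - t0)) by (unfold l; simpl; f_equal; ring).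
  assert (Hs : dir_t = dir_t -> 0 <= t - t0) by (intros _; lra).
  apply Rle_trans with (Ct * Rabs (t - t0)).
  - apply taylor1 with (line dir_t (partial_h dir_t g h) t0 x y) (t - t0); trivial.
    + intros z Hz. apply line_derivative with H (t - t0); trivial; lra.
    + intros z Hz. pose proof (between_Rabs _ _ Hz) as Az.
      rewrite (Rabs_pos_eq (t - t0)) in Az by lra.
      rewrite <- (Rmult_1_r Ct).
      apply Bt; trivial; try lra; try (apply Rabs_le_between; lra).
      intros _; apply between_sign with (2 := Hz); lra.
    + apply between_end.
  - replace (Ct / mu * h ^ 2) with (Ct * (h ^ 2 / mu)) by (field; lra).
    apply Rmult_le_compat_l; trivial. rewrite Rabs_pos_eq; lra. }
replace (g h t x y) with (g h t0 x y + (g h t x y - g h t0 x y)) by ring.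
apply Rle_trans with (1 := Rabs_triang _ _). lra.
Qed.

(** * The operators that annihilate the memory of the scheme *)

Definition rest_op (w : R) (F : grid_family) : grid_family :=
  fun h n i j => next F h n i j - (1 - w) * F h n i j.

(** With [z] the shift in time and [T], [/ T] the shifts in space in the
    direction [d] and in the opposite one, this is the product
    [(z - (1 - w) T) (z - (1 - w) / T)].  One factor annihilates the memory term
    [(1 - w) f] of one of the two opposite distribution functions, the other
    factor that of the other. *)
Definition pair_op (d : direction) (w : R) (F : grid_family) : grid_family :=
  fun h n i j =>
    next (next F) h n i j
    - (1 - w) * (neighbour d 1 (next F) h n i j + neighbour d (-1) (next F) h n i j)
    + (1 - w) ^ 2 * F h n i j.

Lemma gridO_rest_op (mu w : R) (k : nat) (F : grid_family) :
  0 < mu -> gridO mu k F -> gridO mu k (rest_op w F).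
Proof.
intros Hmu OF.
apply gridO_ext with 1 (fun h n i j => next F h n i j + - (1 - w) * F h n i j);
  [lra|intros; unfold rest_op; ring|].
apply gridO_plus; [now apply gridO_next|now apply gridO_scal].
Qed.

Lemma gridO_pair_op (mu w : R) (d : direction) (k : nat) (F : grid_family) :
  0 < mu -> gridO mu k F -> gridO mu k (pair_op d w F).
Proof.
intros Hmu OF.
apply gridO_ext with 1 (fun h n i j => next (next F) h n i j
  + (- (1 - w) * (neighbour d 1 (next F) h n i j + neighbour d (-1) (next F) h n i j)
     + (1 - w) ^ 2 * F h n i j));
  [lra|intros; unfold pair_op; ring|].
assert (On : gridO mu k (next F)) by now apply gridO_next.
apply gridO_plus; [now apply gridO_next|].
apply gridO_plus; apply gridO_scal; trivial.
apply gridO_plus; apply gridO_shift; auto.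
Qed.

Lemma gridO_weaken (mu : R) (k l : nat) (F : grid_family) :
  (l <= k)%nat -> gridO mu k F -> gridO mu l F.
Proof.
intros Hkl OF a b r Ha.
destruct (OF a b r Ha) as [C [h0 [Hh0 B]]].
exists (Rabs C), (Rmin h0 1); split; [apply Rmin_pos; lra|].
intros h n i j [Hh Hm] Ht Hx Hy.
assert (h < h0) by (apply Rlt_le_trans with (1 := Hm); apply Rmin_l).
assert (h < 1) by (apply Rlt_le_trans with (1 := Hm); apply Rmin_r).
apply Rle_trans with (C * h ^ k); [apply B; trivial; lra|].
apply Rle_trans with (Rabs C * h ^ k).
- apply Rmult_le_compat_r; [apply pow_le; lra|apply Rle_abs].
- apply Rmult_le_compat_l; [apply Rabs_pos|].
  replace k with (l + (k - l))%nat by lia. rewrite pow_add.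
  rewrite <- (Rmult_1_r (h ^ l)) at 2.
  apply Rmult_le_compat_l; [apply pow_le; lra|].
  rewrite <- (pow1 (k - l)). apply pow_incr; lra.
Qed.

Lemma lag_next (mu H : R) (g : R -> field) :
  0 < mu -> 0 < H -> usmooth H g ->
  gridO mu 2 (fun h n i j => next (sample mu g) h n i j - sample mu g h n i j).
Proof.
intros Hmu HH Sg.
pose proof (gridO_weaken mu 4 2 _ ltac:(lia) (expand_next mu H g Hmu HH Sg)) as E.
pose proof (usmooth_bounded _ _ (usmooth_partial H dir_t g Sg)) as B.
pose proof (gridO_hmul mu (/ mu) 2 0 _ (gridO_sample mu 0 _ B)) as E'.
refine (gridO_ext mu H 2 _ _ HH _ (gridO_plus mu 2 _ _ E E')).
intros h n i j Hh. field. lra.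
Qed.

Lemma expand_next2 (mu H : R) (g : R -> field) :
  0 < mu -> 0 < H -> usmooth H g ->
  gridO mu 4 (fun h n i j => next (next (sample mu g)) h n i j
    - (sample mu g h n i j
       + 2 * h ^ 2 / mu * sample mu (partial_h dir_t g) h n i j)).
Proof.
intros Hmu HH Sg.
pose proof (expand_next mu H g Hmu HH Sg) as E.
pose proof (gridO_next mu 4 _ Hmu E) as En.
pose proof (lag_next mu H _ Hmu HH (usmooth_partial H dir_t g Sg)) as L.
pose proof (gridO_hmul mu (/ mu) 2 2 _ L) as L'.
refine (gridO_ext mu H 4 _ _ HH _
  (gridO_plus mu 4 _ _ En (gridO_plus mu 4 _ _ E L'))).
intros h n i j Hh. unfold next. field. lra.
Qed.

Lemma expand_sum_next (mu H : R) (d : direction) (g : R -> field) :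
  0 < mu -> 0 < H -> d <> dir_t -> usmooth H g ->
  gridO mu 4 (fun h n i j =>
    neighbour d 1 (next (sample mu g)) h n i j
    + neighbour d (-1) (next (sample mu g)) h n i j
    - (2 * sample mu g h n i j
       + 2 * h ^ 2 / mu * sample mu (partial_h dir_t g) h n i j
       + h ^ 2 * sample mu (partial_h d (partial_h d g)) h n i j)).
Proof.
intros Hmu HH Hd Sg.
pose proof (gridO_next mu 4 _ Hmu (expand_sum mu H d g Hmu HH Hd Sg)) as E.
pose proof (gridO_scal mu 2 4 _ (expand_next mu H g Hmu HH Sg)) as Et.
pose proof (lag_next mu H _ Hmu HH
  (usmooth_partial H d _ (usmooth_partial H d g Sg))) as L.
pose proof (gridO_hmul mu 1 2 2 _ L) as L'.
refine (gridO_ext mu H 4 _ _ HH _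
  (gridO_plus mu 4 _ _ E (gridO_plus mu 4 _ _ Et L'))).
intros h n i j Hh. unfold next, neighbour. destruct d; field; lra.
Qed.

Lemma expand_difference_next (mu H : R) (d : direction) (g : R -> field) :
  0 < mu -> 0 < H -> d <> dir_t -> usmooth H g ->
  gridO mu 3 (fun h n i j =>
    neighbour d 1 (next (sample mu g)) h n i j
    - neighbour d (-1) (next (sample mu g)) h n i j
    - 2 * h * sample mu (partial_h d g) h n i j).
Proof.
intros Hmu HH Hd Sg.
pose proof (gridO_next mu 3 _ Hmu (expand_difference mu H d g Hmu HH Hd Sg)) as E.
pose proof (lag_next mu H _ Hmu HH (usmooth_partial H d g Sg)) as L.
pose proof (gridO_hmul mu 2 1 2 _ L) as L'.
refine (gridO_ext mu H 3 _ _ HH _ (gridO_plus mu 3 _ _ E L')).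
intros h n i j Hh. unfold next, neighbour. destruct d; ring.
Qed.

Lemma expand_rest_op (mu H w : R) (g : R -> field) :
  0 < mu -> 0 < H -> usmooth H g ->
  gridO mu 4 (fun h n i j => rest_op w (sample mu g) h n i j
    - (w * sample mu g h n i j
       + h ^ 2 / mu * sample mu (partial_h dir_t g) h n i j)).
Proof.
intros Hmu HH Sg.
refine (gridO_ext mu H 4 _ _ HH _ (expand_next mu H g Hmu HH Sg)).
intros h n i j Hh. unfold rest_op. ring.
Qed.

Lemma expand_pair_op (mu H w : R) (d : direction) (g : R -> field) :
  0 < mu -> 0 < H -> d <> dir_t -> usmooth H g ->
  gridO mu 4 (fun h n i j => pair_op d w (sample mu g) h n i j
    - (w ^ 2 * sample mu g h n i j
       + h ^ 2 * (2 * w / mu * sample mu (partial_h dir_t g) h n i j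
           - (1 - w) * sample mu (partial_h d (partial_h d g)) h n i j))).
Proof.
intros Hmu HH Hd Sg.
pose proof (expand_next2 mu H g Hmu HH Sg) as E2.
pose proof (gridO_scal mu (- (1 - w)) 4 _
  (expand_sum_next mu H d g Hmu HH Hd Sg)) as Es.
refine (gridO_ext mu H 4 _ _ HH _ (gridO_plus mu 4 _ _ E2 Es)).
intros h n i j Hh. unfold pair_op. field. lra.
Qed.

Lemma leading_rest_op (mu H w : R) (g : R -> field) :
  0 < mu -> 0 < H -> usmooth H g ->
  gridO mu 2 (fun h n i j =>
    rest_op w (sample mu g) h n i j - w * sample mu g h n i j).
Proof.
intros Hmu HH Sg.
refine (gridO_ext mu H 2 _ _ HH _ (lag_next mu H g Hmu HH Sg)).
intros h n i j Hh. unfold rest_op. ring.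
Qed.

Lemma leading_pair_op (mu H w : R) (d : direction) (g : R -> field) :
  0 < mu -> 0 < H -> d <> dir_t -> usmooth H g ->
  gridO mu 2 (fun h n i j =>
    pair_op d w (sample mu g) h n i j - w ^ 2 * sample mu g h n i j).
Proof.
intros Hmu HH Hd Sg.
pose proof (gridO_weaken mu 4 2 _ ltac:(lia)
  (expand_pair_op mu H w d g Hmu HH Hd Sg)) as E.
assert (B : forall g', usmooth H g' -> gridO mu 0 (sample mu g')).
{ intros g' S'. apply gridO_sample. now apply (usmooth_bounded H). }
pose proof (gridO_hmul mu (2 * w / mu) 2 0 _ (B _ (usmooth_partial H dir_t g Sg)))
  as Et.
pose proof (gridO_hmul mu (- (1 - w)) 2 0 _
  (B _ (usmooth_partial H d _ (usmooth_partial H d g Sg)))) as Ed.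
refine (gridO_ext mu H 2 _ _ HH _
  (gridO_plus mu 2 _ _ E (gridO_plus mu 2 _ _ Et Ed))).
intros h n i j Hh. field. lra.
Qed.

(** * Consistency of one scalar five-velocity scheme *)

(** The constants [ca] and [cb] carry the part of the flux that is constant in
    space and time.  It may grow as the step tends to 0, and it cancels between
    opposite velocities. *)
Definition scalar_eq (mu alpha : R) (ca cb : R -> R) (u A B : R -> field)
    (h : R) (n : nat) (i j : Z) (l : velocity) : R :=
  match l with
  | V0 => (1 - 4 * alpha) * sample mu u h n i j
  | Vxp => alpha * sample mu u h n i j
           + (h / (2 * mu) * sample mu A h n i j + ca h)
  | Vxm => alpha * sample mu u h n i j
           - (h / (2 * mu) * sample mu A h n i j + ca h)
  | Vyp => alpha * sample mu u h n i j
           + (h / (2 * mu) * sample mu B h n i j + cb h)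
  | Vym => alpha * sample mu u h n i j
           - (h / (2 * mu) * sample mu B h n i j + cb h)
  end.

(** The second-order term of the approximation [2 alpha u + h ^ 2 P2] of the sum
    of two opposite distribution functions: it is the only choice of [P2] for
    which the terms of order 2 of the recurrence balance, since [pair_op] acts on
    [P2] as the multiplication by [w ^ 2] at leading order. *)
Definition pair_correction (mu alpha w : R) (d : direction) (u A : R -> field)
    : R -> field :=
  fun h t x y =>
    (-2 * alpha / (w * mu)) * partial_h dir_t u h t x y
    + (-1 / (w * mu)) * partial_h d A h t x y
    + ((2 / w ^ 2 - 1 / w) * alpha) * partial_h d (partial_h d u) h t x y.

Lemma pair_expansion (mu H alpha w : R) (d : direction) (u A : R -> field)
    (p : grid_family) :
  0 < mu -> 0 < H -> 0 < w -> d <> dir_t -> usmooth H u -> usmooth H A ->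
  (forall h n i j, 0 < h < H ->
     pair_op d w p h n i j
     = w * (alpha * (neighbour d 1 (next (sample mu u)) h n i j
                     + neighbour d (-1) (next (sample mu u)) h n i j)
            - 2 * (1 - w) * alpha * sample mu u h n i j
            - h / (2 * mu) * (neighbour d 1 (next (sample mu A)) h n i j
                              - neighbour d (-1) (next (sample mu A)) h n i j))) ->
  gridO mu 4 (pair_op d w (fun h n i j => p h n i j
    - (2 * alpha * sample mu u h n i j
       + h ^ 2 * sample mu (pair_correction mu alpha w d u A) h n i j))).
Proof.
intros Hmu HH Hw Hd Su SA Ep.
set (P2 := pair_correction mu alpha w d u A).
assert (SP : usmooth H P2).
{ unfold P2, pair_correction.
  repeat apply usmooth_plus; trivial; apply usmooth_scal; trivial;
    now repeat apply usmooth_partial. }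
pose proof (gridO_scal mu (w * alpha) 4 _
  (expand_sum_next mu H d u Hmu HH Hd Su)) as E1.
pose proof (gridO_hmul mu (- w / (2 * mu)) 1 3 _
  (expand_difference_next mu H d A Hmu HH Hd SA)) as E2.
pose proof (gridO_scal mu (- (2 * alpha)) 4 _
  (expand_pair_op mu H w d u Hmu HH Hd Su)) as E3.
pose proof (gridO_hmul mu (-1) 2 2 _
  (leading_pair_op mu H w d P2 Hmu HH Hd SP)) as E4.
refine (gridO_ext mu H 4 _ _ HH _
  (gridO_plus mu 4 _ _ (gridO_plus mu 4 _ _ E1 E2)
     (gridO_plus mu 4 _ _ E3 E4))).
intros h n i j Hh.
replace (pair_op d w (fun h n i j => p h n i j
    - (2 * alpha * sample mu u h n i j + h ^ 2 * sample mu P2 h n i j)) h n i j)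
  with (pair_op d w p h n i j - 2 * alpha * pair_op d w (sample mu u) h n i j
        - h ^ 2 * pair_op d w (sample mu P2) h n i j)
  by (unfold pair_op, neighbour, next; destruct d; ring).
rewrite (Ep h n i j Hh).
replace (sample mu P2 h n i j) with
  ((-2 * alpha / (w * mu)) * sample mu (partial_h dir_t u) h n i j
    + (-1 / (w * mu)) * sample mu (partial_h d A) h n i j
    + ((2 / w ^ 2 - 1 / w) * alpha)
      * sample mu (partial_h d (partial_h d u)) h n i j) by reflexivity.
generalize (pair_op d w (sample mu u) h n i j)
  (pair_op d w (sample mu P2) h n i j).
intros. field. lra.
Qed.

Lemma rest_expansion (mu H alpha w : R) (u : R -> field) (p : grid_family) :
  0 < mu -> 0 < H -> 0 < w -> usmooth H u ->
  (forall h n i j, 0 < h < H ->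
     rest_op w p h n i j = w * ((1 - 4 * alpha) * sample mu u h n i j)) ->
  gridO mu 4 (rest_op w (fun h n i j => p h n i j
    - (1 - 4 * alpha) * (sample mu u h n i j
       - h ^ 2 / (w * mu) * sample mu (partial_h dir_t u) h n i j))).
Proof.
intros Hmu HH Hw Su Ep.
pose proof (gridO_scal mu (- (1 - 4 * alpha)) 4 _
  (expand_rest_op mu H w u Hmu HH Su)) as E1.
pose proof (gridO_hmul mu ((1 - 4 * alpha) / (w * mu)) 2 2 _
  (leading_rest_op mu H w _ Hmu HH (usmooth_partial H dir_t u Su))) as E2.
refine (gridO_ext mu H 4 _ _ HH _ (gridO_plus mu 4 _ _ E1 E2)).
intros h n i j Hh. pose proof (Ep h n i j Hh) as E.
unfold rest_op, next in *.
replace (p h (S n) i j) with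
  ((1 - w) * p h n i j + w * ((1 - 4 * alpha) * sample mu u h n i j)) by lra.
field. lra.
Qed.

(** The composition of the three operators acts on a smooth family of order 2
    as the multiplication by [w ^ 5], up to the order 4: the first-order terms
    of the two members of a pair cancel. *)
Lemma compose_ops_leading (mu H w : R) (D : R -> field) :
  0 < mu -> 0 < H -> usmooth H D ->
  gridO mu 4 (fun h n i j =>
    rest_op w (pair_op dir_x w (pair_op dir_y w
      (fun h n i j => h ^ 2 * sample mu D h n i j))) h n i j
    - w ^ 5 * (h ^ 2 * sample mu D h n i j)).
Proof.
intros Hmu HH SD.
set (s := sample mu D).
pose proof (gridO_hmul mu 1 2 2 _
  (leading_pair_op mu H w dir_y D Hmu HH ltac:(discriminate) SD)) as Ey.
pose proof (gridO_hmul mu (w ^ 2) 2 2 _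
  (leading_pair_op mu H w dir_x D Hmu HH ltac:(discriminate) SD)) as Ex.
pose proof (gridO_hmul mu (w ^ 4) 2 2 _
  (leading_rest_op mu H w D Hmu HH SD)) as E0.
apply (gridO_pair_op mu w dir_x 4 _ Hmu), (gridO_rest_op mu w 4 _ Hmu) in Ey.
apply (gridO_rest_op mu w 4 _ Hmu) in Ex.
refine (gridO_ext mu H 4 _ _ HH _
  (gridO_plus mu 4 _ _ Ey (gridO_plus mu 4 _ _ Ex E0))).
intros h n i j Hh. fold s. unfold rest_op, pair_op, neighbour, next. ring.
Qed.

Definition consistency_defect (mu alpha w : R) (u A B : R -> field) : R -> field :=
  fun h t x y =>
    partial_h dir_t u h t x y + partial_h dir_x A h t x y
    + partial_h dir_y B h t x y
    + (- (2 * mu * alpha * (1 / w - 1 / 2)))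
      * (partial_h dir_x (partial_h dir_x u) h t x y
         + partial_h dir_y (partial_h dir_y u) h t x y).

Lemma scalar_scheme_consistent (mu H alpha w : R) (ca cb : R -> R)
    (u A B : R -> field) (F : R -> nat -> Z -> Z -> velocity -> R) :
  0 < mu -> 0 < H -> 0 < w -> usmooth H u -> usmooth H A -> usmooth H B ->
  (forall h n i j, 0 < h < H ->
     sum_velocities (F h n i j) = sample mu u h n i j) ->
  (forall h n i j l, 0 < h < H ->
     F h (S n) i j l
     = (1 - w) * F h n (i - cx l)%Z (j - cy l)%Z l
       + w * scalar_eq mu alpha ca cb u A B h n (i - cx l)%Z (j - cy l)%Z l) ->
  bigO 2 (consistency_defect mu alpha w u A B).
Proof.
intros Hmu HH Hw Su SA SB Hsum Hstep.
set (E := consistency_defect mu alpha w u A B).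
assert (SE : usmooth H E).
{ unfold E, consistency_defect.
  repeat apply usmooth_plus; trivial; try (now apply usmooth_partial).
  apply usmooth_scal; trivial.
  apply usmooth_plus; trivial; now repeat apply usmooth_partial. }
apply (bigO_of_grid mu H); trivial.
set (c := / (w * mu)).
set (D := fun h t x y => c * E h t x y).
assert (SD : usmooth H D) by now apply usmooth_scal.
assert (St : forall l h n i j i' j', 0 < h < H ->
  (i - cx l = i')%Z -> (j - cy l = j')%Z ->
  F h (S n) i j l = (1 - w) * F h n i' j' l
    + w * scalar_eq mu alpha ca cb u A B h n i' j' l).
{ intros l h n i j i' j' Hh <- <-. now apply Hstep. }
pose (f0 := (fun h n i j => F h n i j V0) : grid_family).
pose (px := (fun h n i j => F h n i j Vxp + F h n i j Vxm) : grid_family).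
pose (py := (fun h n i j => F h n i j Vyp + F h n i j Vym) : grid_family).
assert (R0 : gridO mu 4 (rest_op w (fun h n i j => f0 h n i j
    - (1 - 4 * alpha) * (sample mu u h n i j
       - h ^ 2 / (w * mu) * sample mu (partial_h dir_t u) h n i j)))).
{ apply rest_expansion with H; trivial.
  intros h n i j Hh. unfold rest_op, next, f0.
  rewrite (St V0 h n i j i j Hh) by (simpl; lia). simpl. ring. }
assert (Rx : gridO mu 4 (pair_op dir_x w (fun h n i j => px h n i j
    - (2 * alpha * sample mu u h n i j
       + h ^ 2 * sample mu (pair_correction mu alpha w dir_x u A) h n i j)))).
{ apply pair_expansion with H; trivial; [discriminate|].
  intros h n i j Hh. unfold pair_op, neighbour, next, px.
  rewrite (St Vxp h (S n) i j (i + -1)%Z j Hh) by (simpl; lia).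
  rewrite (St Vxm h (S n) i j (i + 1)%Z j Hh) by (simpl; lia).
  rewrite (St Vxp h n (i + 1)%Z j i j Hh) by (simpl; lia).
  rewrite (St Vxm h n (i + -1)%Z j i j Hh) by (simpl; lia).
  simpl. ring. }
assert (Ry : gridO mu 4 (pair_op dir_y w (fun h n i j => py h n i j
    - (2 * alpha * sample mu u h n i j
       + h ^ 2 * sample mu (pair_correction mu alpha w dir_y u B) h n i j)))).
{ apply pair_expansion with H; trivial; [discriminate|].
  intros h n i j Hh. unfold pair_op, neighbour, next, py.
  rewrite (St Vyp h (S n) i j i (j + -1)%Z Hh) by (simpl; lia).
  rewrite (St Vym h (S n) i j i (j + 1)%Z Hh) by (simpl; lia).
  rewrite (St Vyp h n i (j + 1)%Z i j Hh) by (simpl; lia).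
  rewrite (St Vym h n i (j + -1)%Z i j Hh) by (simpl; lia).
  simpl. ring. }
apply (gridO_pair_op mu w dir_y 4 _ Hmu), (gridO_pair_op mu w dir_x 4 _ Hmu) in R0.
apply (gridO_pair_op mu w dir_y 4 _ Hmu), (gridO_rest_op mu w 4 _ Hmu) in Rx.
apply (gridO_pair_op mu w dir_x 4 _ Hmu), (gridO_rest_op mu w 4 _ Hmu) in Ry.
pose proof (compose_ops_leading mu H w D Hmu HH SD) as Lead.
assert (Sum : forall h n i j, 0 < h < H ->
  F h n i j V0 = - (F h n i j Vxp + F h n i j Vxm) - (F h n i j Vyp + F h n i j Vym)
    + sample mu u h n i j).
{ intros h n i j Hh. rewrite <- (Hsum h n i j Hh). unfold sum_velocities. ring. }
(* The identity behind the limit equation: the three approximations add up to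
   [u] minus [h ^ 2 D], so that on the grid their errors add up to [h ^ 2 D]. *)
assert (ED : forall h n i j,
  h ^ 2 * sample mu D h n i j
  = sample mu u h n i j
    - (1 - 4 * alpha) * (sample mu u h n i j
       - h ^ 2 / (w * mu) * sample mu (partial_h dir_t u) h n i j)
    - (2 * alpha * sample mu u h n i j
       + h ^ 2 * sample mu (pair_correction mu alpha w dir_x u A) h n i j)
    - (2 * alpha * sample mu u h n i j
       + h ^ 2 * sample mu (pair_correction mu alpha w dir_y u B) h n i j)).
{ intros h n i j.
  unfold D, E, consistency_defect, pair_correction, sample, c. field. lra. }
assert (OD : gridO mu 4 (fun h n i j => w ^ 5 * (h ^ 2 * sample mu D h n i j))).
{ refine (gridO_ext mu H 4 _ _ HH _
    (gridO_plus mu 4 _ _ (gridO_scal mu (-1) 4 _ Lead)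
       (gridO_plus mu 4 _ _ R0 (gridO_plus mu 4 _ _ Rx Ry)))).
  intros h n i j Hh.
  unfold rest_op, pair_op, neighbour, next, f0, px, py.
  rewrite !(Sum h) by trivial. rewrite !ED. ring. }
intros a b r Ha.
destruct (OD a b r Ha) as [C [h0 [Hh0 Bd]]].
exists (w * mu / w ^ 5 * C), h0; split; trivial.
intros h n i j Hh Ht Hx Hy.
specialize (Bd h n i j Hh Ht Hx Hy).
assert (0 < h ^ 2) by (apply pow_lt; lra).
assert (0 < w ^ 5) by (apply pow_lt; lra).
assert (Hc : 0 < w * mu) by now apply Rmult_lt_0_compat.
replace (sample mu E h n i j)
  with (w * mu / w ^ 5 / h ^ 2 * (w ^ 5 * (h ^ 2 * sample mu D h n i j)))
  by (unfold D, sample, c; field; repeat split; lra).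
assert (Hf : 0 < w * mu / w ^ 5 / h ^ 2) by (repeat apply Rdiv_lt_0_compat; trivial).
rewrite Rabs_mult, (Rabs_pos_eq (_ / _)) by lra.
replace (w * mu / w ^ 5 * C * h ^ 2)
  with (w * mu / w ^ 5 / h ^ 2 * (C * h ^ 4)) by (field; lra).
apply Rmult_le_compat_l; lra.
Qed.

(** * Fixed smooth fields are uniformly smooth *)

(** The radius of local control at a point is also chosen smaller than the
    inverse of [Rabs g + 1] there, so that the lower bound on the radii which
    compactness provides bounds the values of [g]. *)
Lemma continuous_bounded_on_box (g : field) (a b r : R) :
  (forall t x y, a <= t <= b ->
     continuous (fun p : R * R * R => g (fst (fst p)) (snd (fst p)) (snd p))
       ((t, x), y)) ->
  exists C, forall t x y, a <= t <= b -> Rabs x <= r -> Rabs y <= r ->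
    Rabs (g t x y) <= C.
Proof.
intro Hc.
assert (Loc : forall p : Compactness.Tn 3 R, exists d : posreal,
  let '(t, (x, (y, _))) := p in
  a <= t <= b ->
  d * (Rabs (g t x y) + 1) <= 1 /\
  forall t' x' y', Rabs (t' - t) < d -> Rabs (x' - x) < d -> Rabs (y' - y) < d ->
    Rabs (g t' x' y' - g t x y) < 1).
{ intros [t [x [y []]]].
  destruct (Rle_dec a t) as [Pa|Na]; [|exists (mkposreal 1 Rlt_0_1); lra].
  destruct (Rle_dec t b) as [Pb|Nb]; [|exists (mkposreal 1 Rlt_0_1); lra].
  destruct (proj1 (filterlim_locally _ _) (Hc t x y (conj Pa Pb))
              (mkposreal 1 Rlt_0_1)) as [e He].
  assert (P : 0 < Rabs (g t x y) + 1) by (pose proof (Rabs_pos (g t x y)); lra).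
  exists (mkposreal (Rmin e (/ (Rabs (g t x y) + 1)))
           (Rmin_pos _ _ (cond_pos e) (Rinv_0_lt_compat _ P))).
  intros _; simpl; split.
  - apply Rle_trans with (/ (Rabs (g t x y) + 1) * (Rabs (g t x y) + 1)).
    + apply Rmult_le_compat_r; [lra|apply Rmin_r].
    + rewrite Rinv_l; lra.
  - intros t' x' y' Ht Hx Hy.
    assert (M : forall s, s < Rmin e (/ (Rabs (g t x y) + 1)) -> s < e).
    { intros s Hs. apply Rlt_le_trans with (1 := Hs). apply Rmin_l. }
    apply (He ((t', x'), y')). repeat split; simpl; now apply M. }
pose (delta := fun p => proj1_sig (constructive_indefinite_description _ (Loc p))).
destruct (compactness_value 3 (a, (- r, (- r, tt))) (b, (r, (r, tt))) delta)
  as [d Hd].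
exists (/ d + 1). intros t x y Ht Hx Hy.
apply Rabs_le_between in Hx, Hy.
apply Rnot_lt_le. intro Hlt.
apply (Hd (t, (x, (y, tt)))); [simpl; tauto|].
intros [[t0 [x0 [y0 []]]] [Hb [Hcl Hdl]]].
unfold delta in Hcl, Hdl.
destruct (constructive_indefinite_description _ _) as [e He]; simpl in *.
destruct (He (proj1 Hb)) as [He1 He2].
assert (Hv : Rabs (g t x y - g t0 x0 y0) < 1) by (apply He2; tauto).
assert (Rabs (g t0 x0 y0) + 1 <= / d).
{ apply Rmult_le_reg_l with d; [apply cond_pos|].
  rewrite Rinv_r by (apply Rgt_not_eq, cond_pos).
  apply Rle_trans with (2 := He1). apply Rmult_le_compat_r; trivial.
  pose proof (Rabs_pos (g t0 x0 y0)); lra. }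
pose proof (Rabs_triang_inv (g t x y) (g t0 x0 y0)). lra.
Qed.

Lemma usmooth_fixed (H : R) (g : field) : smooth g -> usmooth H (fun _ => g).
Proof.
intro Sg. apply usmooth_of_bounds; [now apply Reg_of_smooth|].
intros ds a b r Ha.
destruct (continuous_bounded_on_box (partials ds g) a b r) as [C B].
- intros t x y Ht. apply (Sg ds t x y). lra.
- exists C, 1; split; [lra|]. intros. rewrite Rmult_1_r. now apply B.
Qed.

(** * The density near its reference value *)

Lemma partials_scal (ds : list direction) (c : R) (g : field) (t x y : R) :
  partials ds (fun t x y => c * g t x y) t x y = c * partials ds g t x y.
Proof.
revert t x y; induction ds as [|d ds IH]; intros t x y; simpl; trivial.
rewrite <- partial_scal. destruct d; apply Derive_ext; intro; apply IH.
Qed.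

Lemma smooth_bigO_hdiv (k l : nat) (g : R -> field) :
  smooth_bigO (k + l) g ->
  smooth_bigO l (fun h t x y => / h ^ k * g h t x y).
Proof.
intros Og ds. apply bigO_agree with 1 (fun h t x y =>
  / h ^ k * partials ds (g h) t x y); [lra| |].
- intros h t x y _ _. symmetry; apply partials_scal.
- apply bigO_hdiv, Og.
Qed.

Lemma smooth_bigO_weaken (k l : nat) (g : R -> field) :
  (l <= k)%nat -> smooth_bigO k g -> smooth_bigO l g.
Proof. intros Hkl Og ds. apply bigO_weaken with (1 := Hkl), Og. Qed.

(** Since [gamma] is at least 1, [s ^ gamma] lies beyond [s] as seen from 1.
    This global estimate controls the density by the pressure before any lower
    bound on the density is known. *)
Lemma Rpower_expands_1 (gamma s : R) :
  1 <= gamma -> 0 < s -> Rabs (s - 1) <= Rabs (Rpower s gamma - 1).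
Proof.
intros Hg Hs. destruct (Rle_dec 1 s) as [P|N].
- pose proof (Rle_Rpower s 1 gamma P Hg) as E. rewrite Rpower_1 in E by trivial.
  rewrite !Rabs_pos_eq; lra.
- assert (L : ln s < 0) by (rewrite <- ln_1; apply ln_increasing; lra).
  assert (E : Rpower s gamma <= s).
  { unfold Rpower. rewrite <- (exp_ln s) at 2 by trivial.
    destruct (Req_dec gamma 1) as [->|]; [rewrite Rmult_1_l; lra|].
    apply Rlt_le, exp_increasing. nra. }
  rewrite !Rabs_left1; lra.
Qed.

Lemma Rpower_expands (gamma a s : R) :
  1 <= gamma -> 0 < a -> 0 < s ->
  Rabs (s - a) <= a / Rpower a gamma * Rabs (Rpower s gamma - Rpower a gamma).
Proof.
intros Hg Ha Hs.
assert (Hp : 0 < Rpower a gamma) by apply exp_pos.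
assert (Hq : 0 < s / a) by now apply Rdiv_lt_0_compat.
assert (E : Rpower s gamma = Rpower a gamma * Rpower (s / a) gamma).
{ rewrite Rpower_mult_distr by trivial. f_equal. field. lra. }
replace (s - a) with (a * (s / a - 1)) by (field; lra).
replace (Rpower s gamma - Rpower a gamma)
  with (Rpower a gamma * (Rpower (s / a) gamma - 1)) by (rewrite E; ring).
rewrite !Rabs_mult, (Rabs_pos_eq a), (Rabs_pos_eq (Rpower a gamma)) by lra.
replace (a / Rpower a gamma * (Rpower a gamma * Rabs (Rpower (s / a) gamma - 1)))
  with (a * Rabs (Rpower (s / a) gamma - 1)) by (field; lra).
apply Rmult_le_compat_l; [lra|]. now apply Rpower_expands_1.
Qed.

(** Near the limit [c] the values stay above [c / 2]. *)
Lemma bigO_inv (c : R) (g : R -> field) :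
  0 < c -> bigO 1 (fun h t x y => g h t x y - c) ->
  bigO 0 (fun h t x y => / g h t x y).
Proof.
intros Hc Og a b r Ha.
destruct (Og a b r Ha) as [C [h0 [Hh0 B]]].
assert (HC : 0 < Rabs C + 1) by (pose proof (Rabs_pos C); lra).
assert (Hq : 0 < c / (2 * (Rabs C + 1))) by (apply Rdiv_lt_0_compat; lra).
exists (2 / c), (Rmin h0 (c / (2 * (Rabs C + 1)))); split; [now apply Rmin_pos|].
intros h t x y [Hh Hm] Ht Hx Hy.
apply Rmin_Rgt_l in Hm; destruct Hm as [Hm Hs].
specialize (B h t x y ltac:(lra) Ht Hx Hy). rewrite pow_1 in B.
assert (C * h <= c / 2).
{ apply Rle_trans with ((Rabs C + 1) * (c / (2 * (Rabs C + 1)))).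
  - apply Rle_trans with ((Rabs C + 1) * h).
    + apply Rmult_le_compat_r; [lra|]. pose proof (Rle_abs C); lra.
    + apply Rmult_le_compat_l; lra.
  - apply Req_le; field; lra. }
apply Rabs_le_between in B.
assert (P : c / 2 <= g h t x y) by lra.
rewrite Rmult_1_r, Rabs_pos_eq by (apply Rlt_le, Rinv_0_lt_compat; lra).
replace (2 / c) with (/ (c / 2)) by (field; lra).
apply Rinv_le_contravar; lra.
Qed.

(** What the expansion of the pressure leaves out, after division by [h ^ 2]:
    the size at which it enters the momentum equations. *)
Definition remainder (gamma : R) (rho : R -> field) (rhobar : R) (Phi : field)
    : R -> field :=
  fun h t x y => / h ^ 2 *
    (pressure gamma (rho h t x y)
     - (pressure gamma rhobar + h ^ 2 * rhobar * Phi t x y)).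

Definition excess (gamma : R) (rho : R -> field) (rhobar : R) (Phi : field)
    : R -> field :=
  fun h t x y => rhobar * Phi t x y + remainder gamma rho rhobar Phi h t x y.

Lemma pressure_excess (gamma rhobar : R) (rho : R -> field) (Phi : field)
    (h t x y : R) :
  0 < h ->
  pressure gamma (rho h t x y)
  = pressure gamma rhobar + h ^ 2 * excess gamma rho rhobar Phi h t x y.
Proof. intro Hh. unfold excess, remainder. field. lra. Qed.

Lemma remainder_order (k : nat) (gamma rhobar : R) (rho : R -> field)
    (Phi : field) :
  pressure_expansion (2 + k) gamma rho rhobar Phi ->
  smooth_bigO k (remainder gamma rho rhobar Phi).
Proof. exact (smooth_bigO_hdiv 2 k _). Qed.

Lemma usmooth_remainder (H gamma rhobar : R) (k : nat) (rho : R -> field)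
    (Phi : field) :
  (forall h t x y, 0 < h < H -> 0 < t -> 0 < rho h t x y) ->
  (forall h, 0 < h < H -> smooth (rho h)) -> smooth Phi ->
  pressure_expansion (2 + k) gamma rho rhobar Phi ->
  usmooth H (remainder gamma rho rhobar Phi).
Proof.
intros Hpos Srho SPhi Hexp.
apply usmooth_of_bounds.
- intro l. pose proof (growth_any H) as G.
  apply Reg_agree with (f := fun h t x y =>
    / h ^ 2 * (Rpower (rho h t x y) gamma + - Rpower rhobar gamma)
    + - rhobar * Phi t x y); trivial.
  + intros h t x y Hh Ht. unfold remainder, pressure. field. lra.
  + apply Reg_plus; trivial.
    * apply Reg_mult; trivial; [now apply Reg_const|].
      apply Reg_plus; trivial; [|now apply (Reg_const _ _ _ (fun _ => _))].
      apply Reg_Rpower; trivial. now apply Reg_of_smooth.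
    * apply Reg_mult; trivial; [now apply (Reg_const _ _ _ (fun _ => _))|].
      now apply Reg_of_smooth.
- apply smooth_bigO_weaken with k; [lia|]. now apply remainder_order.
Qed.

Lemma density_close (H gamma rhobar : R) (rho : R -> field) (Phi : field) :
  0 < H -> 1 <= gamma -> 0 < rhobar ->
  (forall h t x y, 0 < h < H -> 0 < t -> 0 < rho h t x y) ->
  usmooth H (excess gamma rho rhobar Phi) ->
  bigO 2 (fun h t x y => rho h t x y - rhobar).
Proof.
intros HH Hg Hb Hpos Se.
assert (Op : bigO 2 (fun h t x y =>
  rhobar / Rpower rhobar gamma
  * (h ^ 2 * excess gamma rho rhobar Phi h t x y))).
{ apply bigO_scal. apply (bigO_hmul 2 0). now apply (usmooth_bounded H). }
intros a b r Ha. destruct (Op a b r Ha) as [C [h0 [Hh0 B]]].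
exists C, (Rmin h0 H); split; [now apply Rmin_pos|].
intros h t x y [Hh Hm] Ht Hx Hy.
apply Rmin_Rgt_l in Hm; destruct Hm as [Hm HhH].
apply Rle_trans with (2 := B h t x y ltac:(lra) Ht Hx Hy).
apply Rle_trans with (1 := Rpower_expands gamma rhobar (rho h t x y) Hg Hb
                             (Hpos h t x y ltac:(lra) ltac:(lra))).
replace (h ^ 2 * excess gamma rho rhobar Phi h t x y)
  with (pressure gamma (rho h t x y) - pressure gamma rhobar)
  by (rewrite (pressure_excess gamma rhobar rho Phi) by trivial; ring).
rewrite Rabs_mult, (Rabs_pos_eq (rhobar / _)); [apply Rle_refl|].
apply Rlt_le, Rdiv_lt_0_compat; trivial. apply exp_pos.
Qed.

Lemma usmooth_inv_density (H gamma rhobar : R) (rho : R -> field) (Phi : field) :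
  0 < H -> 1 <= gamma -> 0 < rhobar ->
  (forall h t x y, 0 < h < H -> 0 < t -> 0 < rho h t x y) ->
  usmooth H rho -> usmooth H (excess gamma rho rhobar Phi) ->
  usmooth H (fun h t x y => / rho h t x y).
Proof.
intros HH Hg Hb Hpos Sr Se k. apply Reg_inv; trivial.
- now apply growth_bounded.
- intros h t x y Hh Ht. apply Rgt_not_eq, Hpos; trivial.
- apply bigO_inv with rhobar; trivial. apply (bigO_weaken 2); [lia|].
  now apply density_close with H gamma Phi.
Qed.

(** The density varies as little as the pressure, since the derivative of the
    pressure law stays away from 0. *)
Lemma density_gradient (H gamma rhobar : R) (d : direction) (rho : R -> field)
    (Phi : field) :
  0 < H -> 1 <= gamma -> 0 < rhobar ->
  (forall h t x y, 0 < h < H -> 0 < t -> 0 < rho h t x y) ->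
  usmooth H rho -> usmooth H (excess gamma rho rhobar Phi) ->
  bigO 2 (partial_h d rho).
Proof.
intros HH Hg Hb Hpos Sr Se.
set (e := excess gamma rho rhobar Phi) in *.
assert (Ee : agree H (fun h t x y => Rpower (rho h t x y) gamma)
  (fun h t x y => Rpower rhobar gamma + h ^ 2 * e h t x y)).
{ intros h t x y Hh _. now apply pressure_excess. }
assert (Op : bigO 2 (fun h t x y => h ^ 2 * e h t x y)).
{ apply (bigO_hmul 2 0). now apply (usmooth_bounded H). }
assert (Oi : bigO 0 (fun h t x y => / Rpower (rho h t x y) gamma)).
{ apply bigO_inv with (Rpower rhobar gamma); [apply exp_pos|].
  apply (bigO_weaken 2); [lia|].
  refine (bigO_agree H 2 _ _ HH _ Op).
  intros h t x y Hh Ht. rewrite (Ee h t x y Hh Ht). ring. }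
assert (Og : bigO 2 (fun h t x y => h ^ 2 * partial_h d e h t x y)).
{ apply (bigO_hmul 2 0), (usmooth_bounded H). now apply usmooth_partial. }
pose proof (bigO_scal _ (/ gamma) _ (bigO_mult 0 2 _ _
  (bigO_mult 0 0 _ _ (usmooth_bounded H _ Sr) Oi) Og)) as O.
refine (bigO_agree H 2 _ _ HH _ O).
intros h t x y Hh Ht.
pose proof (partial_Rpower H gamma d rho Hpos (usmooth_differentiable H d rho Sr)
              h t x y Hh Ht) as E1.
pose proof (partial_agree H d _ _ Ee h t x y Hh Ht) as E2.
assert (De : differentiable H d (fun h t x y => h ^ 2 * e h t x y)).
{ apply (differentiable_mult H d (fun h _ _ _ => h ^ 2));
    [exact (differentiable_const H d _)|now apply usmooth_differentiable]. }
pose proof (partial_plus H d (fun _ _ _ _ => Rpower rhobar gamma) _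
  (differentiable_const H d (fun _ => Rpower rhobar gamma)) De h t x y Hh Ht) as E3.
cbv beta in E1, E2, E3.
rewrite E1, E3 in E2.
rewrite (partial_const d (fun _ => Rpower rhobar gamma)), Rplus_0_l in E2.
unfold partial_h at 2 in E2. rewrite partial_scal in E2.
unfold partial_h at 1. rewrite <- E2.
assert (0 < Rpower (rho h t x y) gamma) by apply exp_pos.
pose proof (Hpos h t x y Hh Ht). field. repeat split; lra.
Qed.

(** * The three equations of the scheme *)

Lemma sampled_step (mu gamma : R) (alpha omega : moment -> R) (H : R)
    (f : R -> distribution) (rho qx qy : R -> field) (h : R) (n : nat) (i j : Z)
    (l : velocity) (m : moment) :
  (forall h, 0 < h < H -> lbm_solution mu gamma alpha omega h (f h)) ->
  sampled_from mu H f rho qx qy -> 0 < h < H ->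
  f h (S n) i j l m
  = (1 - omega m) * f h n (i - cx l)%Z (j - cy l)%Z l m
    + omega m * feq mu gamma alpha h l
        (sample mu rho h n (i - cx l)%Z (j - cy l)%Z)
        (sample mu qx h n (i - cx l)%Z (j - cy l)%Z)
        (sample mu qy h n (i - cx l)%Z (j - cy l)%Z) m.
Proof.
intros Hsol Hs Hh. rewrite (lbm_transport _ _ _ _ _ _ (Hsol h Hh)).
unfold relaxed, feq_of, sample.
now rewrite (sampled_rho _ _ _ _ _ _ Hs), (sampled_qx _ _ _ _ _ _ Hs),
  (sampled_qy _ _ _ _ _ _ Hs).
Qed.

Lemma sample_positive (mu H : R) (f : R -> distribution)
    (rho qx qy : R -> field) (h : R) (n : nat) (i j : Z) :
  0 < mu -> sampled_from mu H f rho qx qy -> 0 < h < H ->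
  0 < sample mu rho h n i j.
Proof.
intros Hmu Hs Hh. apply (sampled_positive _ _ _ _ _ _ Hs); trivial.
apply Rmult_le_pos; [apply pos_INR|].
apply Rlt_le, Rdiv_lt_0_compat; trivial. apply pow_lt; lra.
Qed.

Lemma mass_equation (mu gamma : R) (alpha omega : moment -> R) (H : R)
    (f : R -> distribution) (rho qx qy : R -> field) :
  0 < mu -> 0 < omega Mrho -> 0 < H ->
  (forall h, 0 < h < H -> lbm_solution mu gamma alpha omega h (f h)) ->
  sampled_from mu H f rho qx qy ->
  usmooth H rho -> usmooth H qx -> usmooth H qy ->
  bigO 2 (consistency_defect mu (alpha Mrho) (omega Mrho) rho qx qy).
Proof.
intros Hmu Hw HH Hsol Hs Sr Sx Sy.
apply scalar_scheme_consistent with H (fun _ => 0) (fun _ => 0)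
  (fun h n i j l => f h n i j l Mrho); trivial.
- intros h n i j Hh. exact (sampled_rho _ _ _ _ _ _ Hs h n i j Hh).
- intros h n i j l Hh.
  rewrite (sampled_step _ _ _ _ _ _ _ _ _ h n i j l Mrho Hsol Hs Hh).
  f_equal. f_equal. destruct l; simpl; ring.
Qed.

(** After division by [h], the distribution functions of a momentum component
    follow a scalar scheme in which the pressure has become a flux: its
    reference value is a constant, of order [1 / h], and its excess has the
    size of the convective flux. *)
Lemma momentum_x_equation (mu gamma rhobar : R) (alpha omega : moment -> R)
    (H : R) (f : R -> distribution) (rho qx qy : R -> field) (Phi : field) :
  0 < mu -> 0 < omega Mqx -> 0 < H ->
  (forall h, 0 < h < H -> lbm_solution mu gamma alpha omega h (f h)) ->
  sampled_from mu H f rho qx qy ->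
  usmooth H qx -> usmooth H qy ->
  usmooth H (fun h t x y => / rho h t x y) ->
  usmooth H (excess gamma rho rhobar Phi) ->
  bigO 2 (consistency_defect mu (alpha Mqx) (omega Mqx) qx
    (fun h t x y => qx h t x y * (qx h t x y * / rho h t x y)
                    + excess gamma rho rhobar Phi h t x y)
    (fun h t x y => qx h t x y * (qy h t x y * / rho h t x y))).
Proof.
intros Hmu Hw HH Hsol Hs Sx Sy Si Se.
apply scalar_scheme_consistent with H
  (fun h => pressure gamma rhobar / (2 * mu * h)) (fun _ => 0)
  (fun h n i j l => f h n i j l Mqx / h); trivial.
- apply usmooth_plus; trivial. now repeat apply usmooth_mult.
- now repeat apply usmooth_mult.
- intros h n i j Hh. unfold sample.
  rewrite <- (sampled_qx _ _ _ _ _ _ Hs) by trivial.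
  unfold num_qx, moment_sum, sum_velocities. field. lra.
- intros h n i j l Hh.
  rewrite (sampled_step _ _ _ _ _ _ _ _ _ h n i j l Mqx Hsol Hs Hh).
  generalize (i - cx l)%Z (j - cy l)%Z; intros i' j'.
  pose proof (sample_positive mu H f rho qx qy h n i' j' Hmu Hs Hh) as Hr.
  unfold sample in *.
  destruct l; unfold feq, feq_rest, feq_x, feq_y;
    rewrite ?(pressure_excess gamma rhobar rho Phi) by lra;
    unfold scalar_eq, sample; field; repeat split; trivial; lra.
Qed.

Lemma momentum_y_equation (mu gamma rhobar : R) (alpha omega : moment -> R)
    (H : R) (f : R -> distribution) (rho qx qy : R -> field) (Phi : field) :
  0 < mu -> 0 < omega Mqy -> 0 < H ->
  (forall h, 0 < h < H -> lbm_solution mu gamma alpha omega h (f h)) ->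
  sampled_from mu H f rho qx qy ->
  usmooth H qx -> usmooth H qy ->
  usmooth H (fun h t x y => / rho h t x y) ->
  usmooth H (excess gamma rho rhobar Phi) ->
  bigO 2 (consistency_defect mu (alpha Mqy) (omega Mqy) qy
    (fun h t x y => qy h t x y * (qx h t x y * / rho h t x y))
    (fun h t x y => qy h t x y * (qy h t x y * / rho h t x y)
                    + excess gamma rho rhobar Phi h t x y)).
Proof.
intros Hmu Hw HH Hsol Hs Sx Sy Si Se.
apply scalar_scheme_consistent with H
  (fun _ => 0) (fun h => pressure gamma rhobar / (2 * mu * h))
  (fun h n i j l => f h n i j l Mqy / h); trivial.
- now repeat apply usmooth_mult.
- apply usmooth_plus; trivial. now repeat apply usmooth_mult.
- intros h n i j Hh. unfold sample.
  rewrite <- (sampled_qy _ _ _ _ _ _ Hs) by trivial.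
  unfold num_qy, moment_sum, sum_velocities. field. lra.
- intros h n i j l Hh.
  rewrite (sampled_step _ _ _ _ _ _ _ _ _ h n i j l Mqy Hsol Hs Hh).
  generalize (i - cx l)%Z (j - cy l)%Z; intros i' j'.
  pose proof (sample_positive mu H f rho qx qy h n i' j' Hmu Hs Hh) as Hr.
  unfold sample in *.
  destruct l; unfold feq, feq_rest, feq_x, feq_y;
    rewrite ?(pressure_excess gamma rhobar rho Phi) by lra;
    unfold scalar_eq, sample; field; repeat split; trivial; lra.
Qed.

(** The two momentum equations differ by the exchange of the axes: here [u] is
    the component along [d1] and [v] the one along [d2]. *)
Definition momentum_lhs (d1 d2 : direction) (kappa rhobar : R) (Phi : field)
    (rho u v : R -> field) : R -> field :=
  fun h t x y =>
    partial_h dir_t u h t x y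
    + partial_h d1 (fun h t x y => u h t x y * (u h t x y * / rho h t x y)
                                   + rhobar * Phi t x y) h t x y
    + partial_h d2 (fun h t x y => u h t x y * (v h t x y * / rho h t x y)) h t x y
    + - kappa * (partial_h d1 (partial_h d1 u) h t x y
                 + partial_h d2 (partial_h d2 u) h t x y).

Lemma momentum_x_lhs_eq (H mu alpha omega rhobar : R) (Phi : field)
    (rho qx qy : R -> field) :
  agree H (momentum_lhs dir_x dir_y (2 * mu * alpha * (1 / omega - 1 / 2))
             rhobar Phi rho qx qy)
    (fun h => momentum_x_lhs mu alpha omega rhobar Phi (rho h) (qx h) (qy h)).
Proof.
intros h t x y Hh Ht. unfold momentum_lhs, momentum_x_lhs.
rewrite (partial_agree H dir_x _
  (fun h t x y => qx h t x y ^ 2 / rho h t x y + rhobar * Phi t x y))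
  by (trivial; intros h' t' x' y' _ _; unfold Rdiv; ring).
rewrite (partial_agree H dir_y _
  (fun h t x y => qx h t x y * qy h t x y / rho h t x y))
  by (trivial; intros h' t' x' y' _ _; unfold Rdiv; ring).
unfold laplacian, partial_h, partial. ring.
Qed.

Lemma momentum_y_lhs_eq (H mu alpha omega rhobar : R) (Phi : field)
    (rho qx qy : R -> field) :
  agree H (momentum_lhs dir_y dir_x (2 * mu * alpha * (1 / omega - 1 / 2))
             rhobar Phi rho qy qx)
    (fun h => momentum_y_lhs mu alpha omega rhobar Phi (rho h) (qx h) (qy h)).
Proof.
intros h t x y Hh Ht. unfold momentum_lhs, momentum_y_lhs.
rewrite (partial_agree H dir_y _
  (fun h t x y => qy h t x y ^ 2 / rho h t x y + rhobar * Phi t x y))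
  by (trivial; intros h' t' x' y' _ _; unfold Rdiv; ring).
rewrite (partial_agree H dir_x _
  (fun h t x y => qx h t x y * qy h t x y / rho h t x y))
  by (trivial; intros h' t' x' y' _ _; unfold Rdiv; ring).
unfold laplacian, partial_h, partial. ring.
Qed.

(** Replacing the excess by its limit in the flux costs the order of the
    remainder of the pressure. *)
Lemma momentum_lhs_order (H kappa gamma rhobar : R) (k : nat)
    (d1 d2 : direction) (Phi : field) (rho u v E : R -> field) :
  0 < H -> (k <= 2)%nat ->
  usmooth H u -> usmooth H (fun h t x y => / rho h t x y) ->
  usmooth H (fun _ => Phi) -> usmooth H (remainder gamma rho rhobar Phi) ->
  pressure_expansion (2 + k) gamma rho rhobar Phi ->
  bigO 2 E ->
  agree H E (fun h t x y =>
    partial_h dir_t u h t x y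
    + partial_h d1 (fun h t x y => u h t x y * (u h t x y * / rho h t x y)
                                   + excess gamma rho rhobar Phi h t x y) h t x y
    + partial_h d2 (fun h t x y => u h t x y * (v h t x y * / rho h t x y)) h t x y
    + - kappa * (partial_h d1 (partial_h d1 u) h t x y
                 + partial_h d2 (partial_h d2 u) h t x y)) ->
  bigO k (momentum_lhs d1 d2 kappa rhobar Phi rho u v).
Proof.
intros HH Hk Su Si SPhi Sr Hexp OE EE.
set (R2 := remainder gamma rho rhobar Phi) in *.
set (S := fun h t x y => u h t x y * (u h t x y * / rho h t x y)
                         + rhobar * Phi t x y).
assert (SS : usmooth H S).
{ apply usmooth_plus; trivial; [now repeat apply usmooth_mult|].
  now apply (usmooth_scal H rhobar (fun _ => Phi)). }
assert (OR : bigO k (partial_h d1 R2)).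
{ exact (remainder_order k gamma rhobar rho Phi Hexp (d1 :: nil)). }
refine (bigO_agree H k _ _ HH _
  (bigO_plus k _ _ (bigO_weaken 2 k _ Hk OE) (bigO_scal k (-1) _ OR))).
intros h t x y Hh Ht. rewrite (EE h t x y Hh Ht).
rewrite (partial_agree H d1 (fun h t x y =>
    u h t x y * (u h t x y * / rho h t x y)
    + excess gamma rho rhobar Phi h t x y)
  (fun h t x y => S h t x y + R2 h t x y)); trivial.
- rewrite (partial_plus H d1 S R2) by (trivial; now apply usmooth_differentiable).
  unfold momentum_lhs. fold S. ring.
- intros h' t' x' y' _ _. unfold S, R2, excess. ring.
Qed.

(** * Limits that do not depend on the step *)

Record approx (f f0 : R -> field) : Prop := {
  approx_bounded : bigO 0 f;
  approx_limit_bounded : bigO 0 f0;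
  approx_close : bigO 2 (fun h t x y => f h t x y - f0 h t x y)
}.

Lemma approx_agree (H : R) (f g f0 : R -> field) :
  0 < H -> agree H f g -> approx f f0 -> approx g f0.
Proof.
intros HH E [B B0 C]; split; trivial.
- now apply bigO_agree with H f.
- refine (bigO_agree H 2 _ _ HH _ C).
  intros h t x y Hh Ht; now rewrite (E h t x y Hh Ht).
Qed.

Lemma approx_plus (f f0 g g0 : R -> field) :
  approx f f0 -> approx g g0 ->
  approx (fun h t x y => f h t x y + g h t x y)
    (fun h t x y => f0 h t x y + g0 h t x y).
Proof.
intros [B B0 C] [B' B0' C']; split; try now apply bigO_plus.
refine (bigO_agree 1 2 _ _ Rlt_0_1 _ (bigO_plus 2 _ _ C C')).
intros h t x y _ _; ring.
Qed.

Lemma approx_mult (f f0 g g0 : R -> field) :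
  approx f f0 -> approx g g0 ->
  approx (fun h t x y => f h t x y * g h t x y)
    (fun h t x y => f0 h t x y * g0 h t x y).
Proof.
intros [B B0 C] [B' B0' C']; split; try now apply (bigO_mult 0 0).
now apply bigO_mult_close.
Qed.

Lemma approx_refl (f : R -> field) : bigO 0 f -> approx f f.
Proof.
intro B; split; trivial.
refine (bigO_agree 1 2 _ _ Rlt_0_1 _ (bigO_hmul 2 0 _ (bigO_const 0))).
intros h t x y _ _; ring.
Qed.

Lemma approx_scal (c : R) (f f0 : R -> field) :
  approx f f0 ->
  approx (fun h t x y => c * f h t x y) (fun h t x y => c * f0 h t x y).
Proof.
intro A. apply (approx_mult (fun _ _ _ _ => c) (fun _ _ _ _ => c)); trivial.
apply approx_refl, bigO_const.
Qed.

Record smooth_approx (H : R) (f f0 : R -> field) : Prop := {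
  smooth_approx_usmooth : usmooth H f;
  smooth_approx_limit_usmooth : usmooth H f0;
  smooth_approx_close : smooth_bigO 2 (fun h t x y => f h t x y - f0 h t x y)
}.

Lemma smooth_approx_approx (H : R) (f f0 : R -> field) :
  smooth_approx H f f0 -> approx f f0.
Proof.
intros [S S0 C]; split; try now apply (usmooth_bounded H).
exact (C nil).
Qed.

Lemma partials_agree (H : R) (ds : list direction) (f g : R -> field) :
  agree H f g -> agree H (fun h => partials ds (f h)) (fun h => partials ds (g h)).
Proof.
intro E; induction ds as [|d ds IH]; trivial. exact (partial_agree H d _ _ IH).
Qed.

Lemma smooth_approx_partial (H : R) (d : direction) (f f0 : R -> field) :
  0 < H -> smooth_approx H f f0 ->
  smooth_approx H (partial_h d f) (partial_h d f0).
Proof.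
intros HH [S S0 C]; split; try now apply usmooth_partial.
assert (E : agree H (partial_h d (fun h t x y => f h t x y - f0 h t x y))
  (fun h t x y => partial_h d f h t x y - partial_h d f0 h t x y)).
{ intros h t x y Hh Ht.
  rewrite (partial_agree H d _ (fun h t x y => f h t x y + -1 * f0 h t x y))
    by (trivial; intros h' t' x' y' _ _; ring).
  rewrite (partial_plus H d f (fun h t x y => -1 * f0 h t x y)); trivial.
  - unfold partial_h at 2. rewrite partial_scal. unfold partial_h. ring.
  - now apply usmooth_differentiable.
  - apply usmooth_differentiable. now apply usmooth_scal. }
intro ds. refine (bigO_agree H 2 _ _ HH (partials_agree H ds _ _ E) _).
refine (bigO_agree H 2 _ _ HH _ (C (ds ++ d :: nil)%list)).
intros h t x y _ _. now rewrite partials_app.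
Qed.

(** The limit of [momentum_lhs] when [rho], [u] and [v] tend to [rhobar], [u0]
    and [v0], with the products already differentiated so that it can be
    compared factor by factor; the zeros are the derivatives of [/ rhobar]. *)
Definition limit_lhs (d1 d2 : direction) (kappa rhobar : R) (Phi u0 v0 : field)
    : field :=
  fun t x y =>
    partial dir_t u0 t x y
    + (partial d1 u0 t x y * (u0 t x y * / rhobar)
       + u0 t x y * (partial d1 u0 t x y * / rhobar + u0 t x y * 0)
       + rhobar * partial d1 Phi t x y)
    + (partial d2 u0 t x y * (v0 t x y * / rhobar)
       + u0 t x y * (partial d2 v0 t x y * / rhobar + v0 t x y * 0))
    + - kappa * (partial d1 (partial d1 u0) t x y
                 + partial d2 (partial d2 u0) t x y).

Lemma approx_momentum_lhs (H kappa rhobar : R) (d1 d2 : direction)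
    (Phi u0 v0 : field) (rho u v : R -> field) :
  0 < H -> 0 < rhobar ->
  nonvanishing H rho -> usmooth H rho ->
  usmooth H (fun h t x y => / rho h t x y) -> usmooth H (fun _ => Phi) ->
  bigO 2 (fun h t x y => rho h t x y - rhobar) ->
  (forall d, bigO 2 (partial_h d rho)) ->
  smooth_approx H u (fun _ => u0) -> smooth_approx H v (fun _ => v0) ->
  approx (momentum_lhs d1 d2 kappa rhobar Phi rho u v)
    (fun _ => limit_lhs d1 d2 kappa rhobar Phi u0 v0).
Proof.
intros HH Hb Hn Sr Si SPhi Or Odr Au Av.
set (inv := fun h t x y => / rho h t x y) in *.
assert (Bi : bigO 0 inv) by now apply (usmooth_bounded H).
assert (Ai : approx inv (fun _ _ _ _ => / rhobar)).
{ split; trivial; [apply bigO_const|].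
  refine (bigO_agree H 2 _ _ HH _
    (bigO_scal 2 (- / rhobar) _ (bigO_mult 0 2 _ _ Bi Or))).
  intros h t x y Hh Ht. pose proof (Hn h t x y Hh Ht).
  unfold inv. field. split; trivial; lra. }
assert (Adi : forall d, approx (partial_h d inv) (fun _ _ _ _ => 0)).
{ intro d; split; [|apply bigO_const|].
  - apply (usmooth_bounded H). now apply usmooth_partial.
  - refine (bigO_agree H 2 _ _ HH _ (bigO_scal 2 (-1) _
      (bigO_mult 0 2 _ _ (bigO_mult 0 0 _ _ Bi Bi) (Odr d)))).
    intros h t x y Hh Ht. unfold inv.
    pose proof (usmooth_differentiable H d _ Sr h t x y Hh Ht) as D.
    pose proof (Hn h t x y Hh Ht) as Hnz.
    assert (E : partial_h d (fun h t x y => / rho h t x y) h t x y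
      = -1 * (partial_h d rho h t x y * (/ rho h t x y * / rho h t x y)))
      by (destruct d; exact (Derive_inv_prod _ _ D Hnz)).
    rewrite E. ring. }
assert (Diff : forall d g, usmooth H g -> differentiable H d g)
  by (intros; now apply usmooth_differentiable).
pose proof (smooth_approx_usmooth _ _ _ Au) as Su.
pose proof (smooth_approx_usmooth _ _ _ Av) as Sv.
pose proof (smooth_approx_approx _ _ _ Au) as Au'.
pose proof (smooth_approx_approx _ _ _ Av) as Av'.
assert (Adu : forall d, smooth_approx H (partial_h d u) (partial_h d (fun _ => u0)))
  by (intro; now apply smooth_approx_partial).
assert (Adu' : forall d, approx (partial_h d u) (partial_h d (fun _ => u0)))
  by (intro; now apply (smooth_approx_approx H)).
assert (Adv' : forall d, approx (partial_h d v) (partial_h d (fun _ => v0)))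
  by (intro; apply (smooth_approx_approx H); now apply smooth_approx_partial).
assert (Addu : forall d, approx (partial_h d (partial_h d u))
                           (partial_h d (partial_h d (fun _ => u0))))
  by (intro; apply (smooth_approx_approx H); now apply smooth_approx_partial).
assert (AdPhi : forall d, approx (partial_h d (fun _ => Phi))
                            (partial_h d (fun _ => Phi))).
{ intro d; apply approx_refl, (usmooth_bounded H). now apply usmooth_partial. }
assert (Product : forall d w, usmooth H w ->
  agree H (partial_h d (fun h t x y => u h t x y * (w h t x y * inv h t x y)))
    (fun h t x y =>
       partial_h d u h t x y * (w h t x y * inv h t x y)
       + u h t x y * (partial_h d w h t x y * inv h t x y
                      + w h t x y * partial_h d inv h t x y))).
{ intros d w Sw h t x y Hh Ht.
  rewrite (partial_mult H d u (fun h t x y => w h t x y * inv h t x y));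
    trivial; [|now apply Diff|now apply Diff, usmooth_mult].
  rewrite (partial_mult H d w inv); trivial; now apply Diff. }
apply approx_agree with H (fun h t x y =>
  partial_h dir_t u h t x y
  + (partial_h d1 u h t x y * (u h t x y * inv h t x y)
     + u h t x y * (partial_h d1 u h t x y * inv h t x y
                    + u h t x y * partial_h d1 inv h t x y)
     + rhobar * partial_h d1 (fun _ => Phi) h t x y)
  + (partial_h d2 u h t x y * (v h t x y * inv h t x y)
     + u h t x y * (partial_h d2 v h t x y * inv h t x y
                    + v h t x y * partial_h d2 inv h t x y))
  + - kappa * (partial_h d1 (partial_h d1 u) h t x y
               + partial_h d2 (partial_h d2 u) h t x y)); trivial.
- intros h t x y Hh Ht. unfold momentum_lhs.
  change (fun h t x y => u h t x y * (v h t x y * / rho h t x y))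
    with (fun h t x y => u h t x y * (v h t x y * inv h t x y)).
  rewrite (Product d2 v Sv h t x y Hh Ht).
  rewrite (partial_plus H d1
    (fun h t x y => u h t x y * (u h t x y * inv h t x y))
    (fun h t x y => rhobar * Phi t x y)); trivial.
  + rewrite (Product d1 u Su h t x y Hh Ht).
    rewrite (partial_scal d1 rhobar Phi t x y
      : partial_h d1 (fun _ t x y => rhobar * Phi t x y) h t x y = _).
    reflexivity.
  + apply Diff. now repeat apply usmooth_mult.
  + apply Diff. now apply (usmooth_scal H rhobar (fun _ => Phi)).
- assert (Ap : forall d w w0, approx w (fun _ => w0) ->
    approx (partial_h d w) (partial_h d (fun _ => w0)) ->
    approx
      (fun h t x y => partial_h d u h t x y * (w h t x y * inv h t x y)
         + u h t x y * (partial_h d w h t x y * inv h t x y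
                        + w h t x y * partial_h d inv h t x y))
      (fun _ t x y => partial d u0 t x y * (w0 t x y * / rhobar)
         + u0 t x y * (partial d w0 t x y * / rhobar + w0 t x y * 0))).
  { intros d w w0 Aw Adw.
    exact (approx_plus _ _ _ _
      (approx_mult _ _ _ _ (Adu' d) (approx_mult _ _ _ _ Aw Ai))
      (approx_mult _ _ _ _ Au'
        (approx_plus _ _ _ _ (approx_mult _ _ _ _ Adw Ai)
           (approx_mult _ _ _ _ Aw (Adi d))))). }
  exact (approx_plus _ _ _ _
    (approx_plus _ _ _ _
      (approx_plus _ _ _ _ (Adu' dir_t)
        (approx_plus _ _ _ _ (Ap d1 u u0 Au' (Adu' d1))
           (approx_scal rhobar _ _ (AdPhi d1))))
      (Ap d2 v v0 Av' (Adv' d2)))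
    (approx_scal (- kappa) _ _ (approx_plus _ _ _ _ (Addu d1) (Addu d2)))).
Qed.

(** The limit [g] is itself of order 1, and a fixed field of order 1 is zero. *)
Lemma approx_fixed_improve (H : R) (f : R -> field) (g : field) :
  0 < H -> approx f (fun _ => g) -> bigO 1 f -> bigO 2 f.
Proof.
intros HH [_ _ C] O1.
assert (Og : bigO 1 (fun _ => g)).
{ refine (bigO_agree H 1 _ _ HH _ (bigO_plus 1 _ _ O1
    (bigO_scal 1 (-1) _ (bigO_weaken 2 1 _ ltac:(lia) C)))).
  intros h t x y _ _; ring. }
refine (bigO_agree H 2 _ _ HH _ C).
intros h t x y _ Ht. rewrite (bigO_fixed_zero g t x y Og Ht). ring.
Qed.

Theorem proposition1 :
  forall (mu gamma : R) (alpha omega : moment -> R) (H : R)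
         (f : R -> distribution) (rho qx qy : R -> field),
    0 < mu ->
    1 <= gamma ->
    (forall m : moment, 0 < omega m <= 2) ->
    0 < H ->
    (forall h : R, 0 < h < H -> lbm_solution mu gamma alpha omega h (f h)) ->
    sampled_from mu H f rho qx qy ->
    bigO 2 (fun h =>
      mass_lhs mu (alpha Mrho) (omega Mrho) (rho h) (qx h) (qy h))
    /\
    (forall (rhobar : R) (Phi : field),
       0 < rhobar ->
       smooth Phi ->
       (pressure_expansion 3 gamma rho rhobar Phi ->
        mesh_independent_up_to 2 qx ->
        mesh_independent_up_to 2 qy ->
        bigO 2 (fun h =>
          momentum_x_lhs mu (alpha Mqx) (omega Mqx) rhobar Phi
            (rho h) (qx h) (qy h))
        /\
        bigO 2 (fun h =>
          momentum_y_lhs mu (alpha Mqy) (omega Mqy) rhobar Phi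
            (rho h) (qx h) (qy h)))
       /\
       (forall k : nat, (k = 1 \/ k = 2)%nat ->
        pressure_expansion (2 + k) gamma rho rhobar Phi ->
        bigO k (fun h =>
          momentum_x_lhs mu (alpha Mqx) (omega Mqx) rhobar Phi
            (rho h) (qx h) (qy h))
        /\
        bigO k (fun h =>
          momentum_y_lhs mu (alpha Mqy) (omega Mqy) rhobar Phi
            (rho h) (qx h) (qy h)))).
Proof.
intros mu gamma alpha omega H f rho qx qy Hmu Hgamma Homega HH Hsol Hs.
assert (Hw : forall m, 0 < omega m) by (intro m; apply Homega).
assert (Hpos : forall h t x y, 0 < h < H -> 0 < t -> 0 < rho h t x y).
{ intros h t x y Hh Ht. apply (sampled_positive _ _ _ _ _ _ Hs); trivial; lra. }
assert (Srho : forall h, 0 < h < H -> smooth (rho h))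
  by (intros h Hh; exact (proj1 (sampled_smooth _ _ _ _ _ _ Hs h Hh))).
assert (Sqx : forall h, 0 < h < H -> smooth (qx h))
  by (intros h Hh; exact (proj1 (proj2 (sampled_smooth _ _ _ _ _ _ Hs h Hh)))).
assert (Sqy : forall h, 0 < h < H -> smooth (qy h))
  by (intros h Hh; exact (proj2 (proj2 (sampled_smooth _ _ _ _ _ _ Hs h Hh)))).
destruct (sampled_bounded _ _ _ _ _ _ Hs) as [Br [Bx By]].
pose proof (usmooth_of_bounds H rho (Reg_of_smooth H rho Srho) Br) as Sr.
pose proof (usmooth_of_bounds H qx (Reg_of_smooth H qx Sqx) Bx) as Sx.
pose proof (usmooth_of_bounds H qy (Reg_of_smooth H qy Sqy) By) as Sy.
split.
{ refine (bigO_agree H 2 _ _ HH _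
    (mass_equation mu gamma alpha omega H f rho qx qy Hmu (Hw _) HH Hsol Hs
       Sr Sx Sy)).
  intros h t x y _ _.
  unfold consistency_defect, mass_lhs, laplacian, partial_h, partial. ring. }
intros rhobar Phi Hb SPhi.
pose proof (usmooth_fixed H Phi SPhi) as UPhi.
assert (Regular : forall k, pressure_expansion (2 + k) gamma rho rhobar Phi ->
  usmooth H (remainder gamma rho rhobar Phi)
  /\ usmooth H (excess gamma rho rhobar Phi)
  /\ usmooth H (fun h t x y => / rho h t x y)).
{ intros k Hexp.
  assert (SR : usmooth H (remainder gamma rho rhobar Phi)).
  { now apply usmooth_remainder with k. }
  assert (SE : usmooth H (excess gamma rho rhobar Phi)).
  { apply usmooth_plus; trivial.
    now apply (usmooth_scal H rhobar (fun _ => Phi)). }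
  repeat split; trivial.
  now apply usmooth_inv_density with gamma rhobar Phi. }
assert (Orders : forall k, (k <= 2)%nat ->
  pressure_expansion (2 + k) gamma rho rhobar Phi ->
  bigO k (momentum_lhs dir_x dir_y
    (2 * mu * alpha Mqx * (1 / omega Mqx - 1 / 2)) rhobar Phi rho qx qy)
  /\ bigO k (momentum_lhs dir_y dir_x
    (2 * mu * alpha Mqy * (1 / omega Mqy - 1 / 2)) rhobar Phi rho qy qx)).
{ intros k Hk Hexp. destruct (Regular k Hexp) as [SR [SE Si]].
  split.
  - refine (momentum_lhs_order H _ gamma rhobar k _ _ Phi rho qx qy _ HH Hk
      Sx Si UPhi SR Hexp
      (momentum_x_equation mu gamma rhobar alpha omega H f rho qx qy Phi
         Hmu (Hw _) HH Hsol Hs Sx Sy Si SE) _).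
    intros h t x y _ _. unfold consistency_defect. ring.
  - refine (momentum_lhs_order H _ gamma rhobar k _ _ Phi rho qy qx _ HH Hk
      Sy Si UPhi SR Hexp
      (momentum_y_equation mu gamma rhobar alpha omega H f rho qx qy Phi
         Hmu (Hw _) HH Hsol Hs Sx Sy Si SE) _).
    intros h t x y _ _. unfold consistency_defect. ring. }
split.
- intros Hexp [qx0 [Sx0 Cx]] [qy0 [Sy0 Cy]].
  destruct (Regular 1%nat Hexp) as [SR [SE Si]].
  destruct (Orders 1%nat ltac:(lia) Hexp) as [Ox Oy].
  assert (Hn : nonvanishing H rho).
  { intros h t x y Hh Ht. now apply Rgt_not_eq, Hpos. }
  pose proof (density_close H gamma rhobar rho Phi HH Hgamma Hb Hpos SE) as Cr.
  assert (Cdr : forall d, bigO 2 (partial_h d rho)).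
  { intro d. now apply density_gradient with H gamma rhobar Phi. }
  assert (Ax : smooth_approx H qx (fun _ => qx0))
    by (split; trivial; now apply usmooth_fixed).
  assert (Ay : smooth_approx H qy (fun _ => qy0))
    by (split; trivial; now apply usmooth_fixed).
  split.
  + refine (bigO_agree H 2 _ _ HH (momentum_x_lhs_eq H _ _ _ _ _ _ _ _) _).
    refine (approx_fixed_improve H _ _ HH _ Ox).
    now apply (approx_momentum_lhs H _ _ dir_x dir_y Phi qx0 qy0).
  + refine (bigO_agree H 2 _ _ HH (momentum_y_lhs_eq H _ _ _ _ _ _ _ _) _).
    refine (approx_fixed_improve H _ _ HH _ Oy).
    now apply (approx_momentum_lhs H _ _ dir_y dir_x Phi qy0 qx0).
- intros k Hk Hexp.
  destruct (Orders k ltac:(lia) Hexp) as [Ox Oy]. split.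
  + exact (bigO_agree H k _ _ HH (momentum_x_lhs_eq H _ _ _ _ _ _ _ _) Ox).
  + exact (bigO_agree H k _ _ HH (momentum_y_lhs_eq H _ _ _ _ _ _ _ _) Oy).
Qed.
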